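(* Let $(A_r)_{r\ge 0}$ be a sequence of diagram algebras over $R$ (conditions (D1)–(D6) of the context), let $\pi:R\to S$ and $\phi_r:A_r^{\mathbb K}\to Q_r^{\mathbb K}$ be as in the context, and assume (Q1)–(Q3). Let $\ker(\phi_r)$ denote the kernel of $\phi_r$ on $A_r^S$. Then for every $r$: (1) $\ker(\phi_r)$ is globally invariant under the involution $*$. Hence one can define an algebra involution on $Q_r^S=\phi_r(A_r^S)$ by $(\phi_r(a))^*=\phi_r(a^* )$. (2) The algebra $Q_r^S=\phi_r(A_r^S)$ is a cellular algebra over $S$ with cellular basis $$\mathbb A_r=\{\phi_r(m^\lambda_{\mathsf s\mathsf t})\ :\ \lambda\in\widehat A_{r,\mathrm{perm}},\ \mathsf s,\mathsf t\in \mathrm{Std}_{r,\mathrm{perm}}(\lambda)\}.$$ More precisely, the cell datum is the following: the involution $*$ on $Q_r^S$ from (1); the partially ordered set $(\widehat A_{r,\mathrm{perm}},\trianglerighteq)$ of permissible points; for each $\lambda\in\widehat A_{r,\mathrm{perm}}$ the index set $\mathrm{Std}_{r,\mathrm{perm}}(\lambda)$ of permissible paths; and the basis $\mathbb A_r$. (3) The set $\kappa_r=\{\widetilde m^\lambda_{\mathsf s\mathsf t}: \lambda\in\widehat A_r,\ \mathsf s,\mathsf t\in\mathrm{Std}_r(\lambda),\ \mathsf s\text{ or }\mathsf t\text{ is not permissible}\}$ is an $S$-basis of $\ker(\phi_r)$. (4) $\ker(\phi_r)$ is the ideal of $A_r^S$ generated by the set of all $\mathfrak b_\mu$, where $\mu$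 is a marginal point of $\widehat A_s$ for some $0<s\le r$.
   Context: **Cellular algebras.** Let $R$ be an integral domain and $A$ a unital $R$-algebra. A cell datum for $A$ consists of an $R$-linear anti-automorphism $*$ of $A$ with $(x^* )^*=x$, a finite poset $(\widehat A,\trianglerighteq)$, a finite set $\mathrm{Std}(\lambda)$ for each $\lambda\in\widehat A$, and an $R$-basis $\{c^\lambda_{\mathsf s\mathsf t}:\lambda\in\widehat A,\ \mathsf s,\mathsf t\in\mathrm{Std}(\lambda)\}$ (a cellular basis) such that, writing $A^{\triangleright\lambda}$ (resp. $A^{\trianglerighteq\lambda}$) for the $R$-span of all $c^\mu_{\mathsf s\mathsf t}$ with $\mu\triangleright\lambda$ (resp. $\mu\trianglerighteq\lambda$): (a) for $\lambda\in\widehat A$, $\mathsf t\in\mathrm{Std}(\lambda)$, $a\in A$ there are $r(a;\mathsf t,\mathsf v)\in R$ with $c^\lambda_{\mathsf s\mathsf t}a\equiv\sum_{\mathsf v}r(a;\mathsf t,\mathsf v)c^\lambda_{\mathsf s\mathsf v}\bmod A^{\triangleright\lambda}$ for all $\mathsf s$; (b) $(c^\lambda_{\mathsf s\mathsf t})^*\equiv c^\lambda_{\mathsf t\mathsf s}\bmod A^{\triangleright\lambda}$. An algebra with a cell datum is cellular. The cell module $\Delta(\lambda)$ is the right $A$-module with $R$-basis $\{c^\lambda_{\mathsf t}\}$ and $c^\lambda_{\mathsf t}a=\sum_{\mathsf v}r(a;\mathsf t,\mathsf v)c^\lambda_{\mathsf v}$. $A$ is cyclic cellular if every $\Delta(\lambda)$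 is a cyclic module. There is a bimodule isomorphism $\alpha_\lambda:A^{\trianglerighteq\lambda}/A^{\triangleright\lambda}\to\Delta(\lambda)^*\otimes_R\Delta(\lambda)$, $c^\lambda_{\mathsf s\mathsf t}+A^{\triangleright\lambda}\mapsto(c^\lambda_{\mathsf s})^*\otimes c^\lambda_{\mathsf t}$ ($M^*$ is the left module obtained from a right module $M$ via $*$). If $\delta(\lambda)$ generates $\Delta(\lambda)$, a cell generator is an element $m_\lambda\in A^{\trianglerighteq\lambda}$ with $\alpha_\lambda(m_\lambda+A^{\triangleright\lambda})=\delta(\lambda)^*\otimes\delta(\lambda)$; then $\Delta(\lambda)\cong(m_\lambda A+A^{\triangleright\lambda})/A^{\triangleright\lambda}$ with $\delta(\lambda)\leftrightarrow m_\lambda+A^{\triangleright\lambda}$. Two cellular bases are equivalent if they determine the same ideals $A^{\trianglerighteq\lambda}$ and isomorphic cell modules. **Sequences of diagram algebras.** $R$ is an integral domain with field of fractions $\mathbb F$, and $(A_r)_{r\ge0}$ is an increasing sequence of cellular $R$-algebras with unital inclusions and consistent involutions; $(\widehat A_r,\trianglerighteq)$ is the poset and $\Delta_r(\lambda)$ are the cell modules of $A_r$. Assumptions: (D1) $A_0=R$. (D2) Each $A_r$ is cyclic cellular; generators $\delta_r(\lambda)$ and cell generators $m_\lambda$ are fixed, with $m_\varnothing=1$ for the unique element $\varnothing$ of $\widehat A_0$. (D3) $m_\lambda=m_\lambda^*$. (D4) $A_r^{\mathbb F}=A_r\otimes_R\mathbb F$ is split semisimple. (D5) For all $r\ge1$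 and $\mu\in\widehat A_r$, the restriction of $\Delta_r(\mu)$ to $A_{r-1}$ has an order preserving cell filtration, i.e. a filtration $0=M_0\subseteq\dots\subseteq M_n$ with $M_i/M_{i-1}\cong\Delta_{r-1}(\lambda^{(i)})$ and $\lambda^{(i)}\triangleright\lambda^{(i+1)}$. The branching diagram $\widehat A=\bigsqcup_r\widehat A_r$ has an edge $\lambda\to\mu$ ($\lambda\in\widehat A_{r-1}$, $\mu\in\widehat A_r$) iff $\Delta_{r-1}(\lambda)$ occurs as a subquotient in such a filtration of $\Delta_r(\mu)$. $\mathrm{Std}_r(\nu)$ is the set of paths $\mathsf t=(\varnothing=\mathsf t(0)\to\mathsf t(1)\to\dots\to\mathsf t(r)=\nu)$. Fix down-branching factors $d_{\lambda\to\mu}\in A_r$, meaning: if $\mu(1)\triangleright\dots\triangleright\mu(n)$ are the points with $\mu(j)\to\nu$, then $\Delta_r(\nu)$ has a filtration $0=M_0\subset\dots\subset M_n$ by $A_{r-1}$-submodules and isomorphisms $M_j/M_{j-1}\cong\Delta_{r-1}(\mu(j))$ carrying $\delta_r(\nu)d_{\mu(j)\to\nu}+M_{j-1}$ to $\delta_{r-1}(\mu(j))$. (D6) There are up-branching factors $u_{\lambda\to\mu}\in A_r$ with $m_\mu d_{\lambda\to\mu}=(u_{\lambda\to\mu})^*m_\lambda$. For a path segment $\mathsf t_{[q,s]}=(\mathsf t(q)\to\dots\to\mathsf t(s))$ put $d_{\mathsf t_{[q,s]}}=d_{\mathsf t(s-1)\to\mathsf t(s)}\cdots d_{\mathsf t(q)\to\mathsf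 t(q+1)}$, and $d_{\mathsf t}=d_{\mathsf t_{[0,r]}}$. Then $m^\lambda_{\mathsf s\mathsf t}=d_{\mathsf s}^*m_\lambda d_{\mathsf t}$ ($\lambda\in\widehat A_r$, $\mathsf s,\mathsf t\in\mathrm{Std}_r(\lambda)$) is a cellular basis of $A_r$ equivalent to the original one (Murphy basis), and $m^\lambda_{\mathsf t}=m_\lambda d_{\mathsf t}+A_r^{\triangleright\lambda}$ is a basis of $\Delta_r(\lambda)$. **Quotients.** $S$ is an integral domain with field of fractions $\mathbb K$ and algebraic closure $\overline{\mathbb K}$ of $\mathbb K$; $\pi:R\to S$ is a surjective ring homomorphism; $A_r^S=A_r\otimes_RS$, $A_r^{\mathbb K}=A_r\otimes_R\mathbb K$ (same symbols are used for images of elements). $(Q_r^{\mathbb K})_{r\ge0}$ is a tower of unital $\mathbb K$-algebras with common identity, with surjective homomorphisms $\phi_r:A_r^{\mathbb K}\to Q_r^{\mathbb K}$ compatible with the inclusions (often written $\phi$), and $Q_r^S=\phi_r(A_r^S)$. Assumptions: (Q1) There is a subset $\widehat A_{r,\mathrm{perm}}\subseteq\widehat A_r$ of permissible points for each $r$; $\varnothing$ is permissible; each permissible $\mu\in\widehat A_r$ has some permissible $\nu\in\widehat A_{r+1}$ with $\mu\to\nu$ and, if $r\ge1$, some permissible $\lambda\in\widehat A_{r-1}$ with $\lambda\to\mu$. A path is permissible if all its vertices are; $\mathrm{Std}_{r,\mathrm{perm}}(\nu)$ is the set of permissible paths in $\mathrm{Std}_r(\nu)$. (Q2) If $\mathsf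 t\in\mathrm{Std}_r(\nu)$ is not permissible, $1\le k\le r$ is the first index with $\mu=\mathsf t(k)$ not permissible, then there are $\mathfrak b_\mu,\mathfrak b'_\mu\in A_k^S$ with $m_\mu=\mathfrak b_\mu-\mathfrak b'_\mu$, $\mathfrak b_\mu\in\ker(\phi)$, and $\mathfrak b'_\mu\in m_\mu A_k^{\mathbb K}\cap(A_k^S)^{\triangleright\mu}$. (Q3) $\dim_{\overline{\mathbb K}}(Q_r^{\overline{\mathbb K}})=\sum_{\nu\in\widehat A_{r,\mathrm{perm}}}(\sharp\mathrm{Std}_{r,\mathrm{perm}}(\nu))^2$. **Modified Murphy basis.** For $\mathsf t\in\mathrm{Std}_r(\lambda)$ permissible put $a_{\mathsf t}=d_{\mathsf t}$. For $\mathsf t$ not permissible let $k$ and $\mu=\mathsf t(k)$ be as in (Q2), choose $\beta_\mu\in A_k^{\mathbb K}$ with $\mathfrak b_\mu=m_\mu\beta_\mu$, and put $a_{\mathsf t}=d_{\mathsf t_{[k,r]}}\beta_\mu d_{\mathsf t_{[0,k]}}$. Put $\widetilde m^\lambda_{\mathsf s\mathsf t}=a_{\mathsf s}^*m_\lambda a_{\mathsf t}$. **Marginal points.** $\mu\in\widehat A_s$ is marginal if $\mu$ is not permissible and there is $\mathsf t\in\mathrm{Std}_s(\mu)$ with $\mathsf t(k)$ permissible for all $k<s$; $\mathfrak b_\mu$ is then the element from (Q2).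
   Formalization: Part (3) is stated under the extra assumption that every m̃^λ_{st} with both s and t not permissible lies in A_r^S; without it κ_r need not be contained in A_r^S, so (3) as written can fail. *)

(* Defs.v *)
From HB Require Import structures.
From mathcomp Require Export all_boot all_order all_algebra.

Set Implicit Arguments.
Unset Strict Implicit.
Unset Printing Implicit Defensive.

Import Order.TTheory GRing.Theory.

#[global] Open Scope ring_scope.

(* ------------------------- Linear algebra ------------------------------- *)

Definition lin_comb (R : pzRingType) (V : lmodType R) (I : finType)
    (b : I -> V) (k : {ffun I -> R}) : V := \sum_i k i *: b i.

Definition is_basis_of (R : pzRingType) (V : lmodType R) (I : finType)
    (N : V -> Prop) (b : I -> V) : Prop :=
  (forall i, N (b i)) /\
  (forall x, N x -> exists! k : {ffun I -> R}, x = lin_comb b k).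

Definition is_basis (R : pzRingType) (V : lmodType R) (I : finType)
    (b : I -> V) : Prop := is_basis_of (fun _ : V => True) b.

Definition has_dim (F : fieldType) (V : lmodType F) (n : nat) : Prop :=
  exists b : 'I_n -> V, is_basis b.

Definition semilinear_over (R S : pzRingType) (f : R -> S) (M : lmodType R)
    (N : lmodType S) (g : M -> N) : Prop :=
  forall k x y, g (k *: x + y) = f k *: g x + g y.

(* [N], with the map [iota : M -> N], x |-> x (x) 1, is the base change
   M (x)_R S along [f : R -> S]; the tensor product is specified by its
   universal property. *)
Definition is_base_change (R S : pzRingType) (f : R -> S) (M : lmodType R)
    (N : lmodType S) (iota : M -> N) : Prop :=
  semilinear_over f iota /\
  forall (P : lmodType S) (g : M -> P), semilinear_over f g ->
    exists h : {linear N -> P},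
      (forall x, h (iota x) = g x) /\
      (forall h' : {linear N -> P}, (forall x, h' (iota x) = g x) -> h' =1 h).

(* A is isomorphic to a finite product of full matrix algebras over F, the
   isomorphism being given by its components [rho i]. *)
Definition split_semisimple (F : fieldType) (A : algType F) : Prop :=
  exists (I : finType) (n : I -> nat)
         (rho : forall i, {lrmorphism A -> 'M[F]_((n i).+1)}),
    (forall x, (forall i, rho i x = 0) -> x = 0) /\
    (forall B : (forall i, 'M[F]_((n i).+1)), exists x, forall i, rho i x = B i).

Definition two_sided_ideal (A : pzRingType) (I : A -> Prop) : Prop :=
  [/\ I 0, (forall x y, I x -> I y -> I (x + y)) &
      (forall a x b, I x -> I (a * x * b))].

Definition ideal_generated (A : pzRingType) (X : A -> Prop) (x : A) : Prop :=
  forall I : A -> Prop, two_sided_ideal I -> (forall y, X y -> I y) -> I x.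

Definition is_algebra_involution (R : pzRingType) (A : algType R)
    (star : A -> A) : Prop :=
  [/\ (forall k x y, star (k *: x + y) = k *: star x + star y),
      (forall x y, star (x * y) = star y * star x) &
      (forall x, star (star x) = x)].

(* ------------------------- Cellular algebras ---------------------------- *)

Section Cellular.

(* The partial order of the paper is the reverse of reading: mu |> lambda is
   [lam < mu]. *)
Variables (R : idomainType) (A : algType R) (disp : Order.disp_t).
Variables (L : finPOrderType disp) (Std : L -> finType).
Variable c : forall lam, Std lam -> Std lam -> A.

(* the R-span of all c^mu_st with mu in P *)
Definition cell_span (P : pred L) (x : A) : Prop :=
  exists k : (forall mu, Std mu -> Std mu -> R),
    x = \sum_(mu | P mu) \sum_s \sum_t k mu s t *: c s t.

Definition above (lam : L) (x : A) : Prop :=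
  cell_span (fun mu => (lam < mu)%O) x.

Definition above_eq (lam : L) (x : A) : Prop :=
  cell_span (fun mu => (lam <= mu)%O) x.

Definition cell_family (i : {lam : L & (Std lam * Std lam)%type}) : A :=
  c (tagged i).1 (tagged i).2.

Definition is_cell_datum (star : A -> A) : Prop :=
  [/\ is_algebra_involution star,
      is_basis cell_family,
      (forall lam (t : Std lam) (a : A), exists r : Std lam -> R,
         forall s : Std lam, above lam (c s t * a - \sum_v r v *: c s v)) &
      (forall lam (s t : Std lam), above lam (star (c s t) - c t s))].

Variable coef : A -> forall lam, Std lam -> Std lam -> R.

(* [coef a t v] is the structure constant r(a; t, v). *)
Definition is_cell_coef : Prop :=
  forall lam (t : Std lam) (a : A) (s : Std lam),
    above lam (c s t * a - \sum_v coef a t v *: c s v).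

(* The cell module: x stands for sum_t x(t) c_t, and a acts on the right. *)
Definition cell_act lam (x : {ffun Std lam -> R}) (a : A) :
    {ffun Std lam -> R} := [ffun v => \sum_t x t * coef a t v].

Definition generates_cell_mod lam (x : {ffun Std lam -> R}) : Prop :=
  forall y, exists a, y = cell_act x a.

(* A representative of the inverse image of x^* (x) y under the bimodule
   isomorphism alpha_lam : c^lam_st + A^{|> lam} |-> (c_s)^* (x) c_t. *)
Definition alpha_inv lam (x y : {ffun Std lam -> R}) : A :=
  \sum_s \sum_t (x s * y t) *: c s t.

Definition is_cell_generator lam (x : {ffun Std lam -> R}) (m : A) : Prop :=
  above_eq lam m /\ above lam (m - alpha_inv x x).

End Cellular.

(* ------------------ Sequences of diagram algebras ----------------------- *)

(* The algebras A_r with their inclusions and involutions, their cell data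
   (points, index sets, cellular basis, structure constants), the generators
   delta_r(lam), the cell generators m_lam = [cgen lam], the branching diagram
   and the down-branching factors [dbr]. *)
Record diagram_data (R : idomainType) := DiagramData {
  pt_disp : Order.disp_t;
  alg : nat -> algType R;
  incl : forall r, {lrmorphism alg r -> alg r.+1};
  star : forall r, alg r -> alg r;
  pt : nat -> finPOrderType pt_disp;
  std : forall r, pt r -> finType;
  cbasis : forall r (lam : pt r), std lam -> std lam -> alg r;
  coef : forall r, alg r -> forall lam : pt r, std lam -> std lam -> R;
  delta : forall r (lam : pt r), {ffun std lam -> R};
  cgen : forall r, pt r -> alg r;
  pt0 : pt 0;
  edge : forall r, pt r -> pt r.+1 -> bool;
  (* only the values of [dbr] along edges are meaningful *)
  dbr : forall r, pt r -> pt r.+1 -> alg r.+1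
}.

Arguments alg {R} d r.
Arguments incl {R} d r.
Arguments star {R d r} x.
Arguments pt {R} d r.
Arguments std {R d r} lam.
Arguments cbasis {R} d r lam s t.
Arguments coef {R} d r a lam s t.
Arguments delta {R d r} lam.
Arguments cgen {R d r} lam.
Arguments pt0 {R} d.
Arguments edge {R d r} lam mu.
Arguments dbr {R d r} lam mu.

Section Diagram.

Variables (R : idomainType) (D : diagram_data R).

(* the cell module Delta_r(lam), with its right action of A_r *)
Definition Delta r (lam : pt D r) := {ffun std lam -> R}.

Definition act r (lam : pt D r) (x : Delta lam) (a : alg D r) : Delta lam :=
  cell_act (coef D r) x a.

Section Filtration.

Variables (r : nat) (nu : pt D r.+1).

(* [f] induces an isomorphism of A_r-modules N/M ~ Delta_r(lam) *)
Definition quotient_iso (N M : Delta nu -> Prop) (lam : pt D r)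
    (f : Delta nu -> Delta lam) : Prop :=
  [/\ (forall x y, N x -> N y -> f (x + y) = f x + f y),
      (forall x a, N x -> f (act x (incl D r a)) = act (f x) a),
      (forall y, exists2 x, N x & f x = y) &
      (forall x, N x -> (f x = 0 <-> M x))].

Definition restricted_submodule (N : Delta nu -> Prop) : Prop :=
  [/\ N 0, (forall x y, N x -> N y -> N (x + y)) &
      (forall x a, N x -> N (act x (incl D r a)))].

(* 0 = M_0 <= ... <= M_n = Delta_{r+1}(nu) is a filtration by A_r-submodules,
   and f_j : M_{j+1} -> Delta_r(lam_j) induces an isomorphism
   M_{j+1}/M_j ~ Delta_r(lam_j); indices j start at 0. *)
Definition cell_filtration n (lam : 'I_n -> pt D r)
    (M : nat -> Delta nu -> Prop)
    (f : forall j : 'I_n, Delta nu -> Delta (lam j)) : Prop :=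
  [/\ (forall x, M 0%N x <-> x = 0),
      (forall x, M n x),
      (forall j, (j <= n)%N -> restricted_submodule (M j)),
      (forall (j : 'I_n) x, M j x -> M j.+1 x) &
      (forall j : 'I_n, quotient_iso (M j.+1) (M j) (f j))].

Definition decreasing n (lam : 'I_n -> pt D r) : Prop :=
  forall i j : 'I_n, (i < j)%N -> (lam j < lam i)%O.

Definition order_preserving_filtration n (lam : 'I_n -> pt D r) : Prop :=
  decreasing lam /\ exists M f, cell_filtration (lam := lam) M f.

Definition down_branching : Prop :=
  exists n (lam : 'I_n -> pt D r),
    [/\ decreasing lam,
        (forall l, edge l nu <-> exists j, lam j = l) &
        exists M f,
          cell_filtration (lam := lam) M f /\
          forall j : 'I_n, M j.+1 (act (delta nu) (dbr (lam j) nu)) /\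
                    f j (act (delta nu) (dbr (lam j) nu)) = delta (lam j)].

End Filtration.

Record is_diagram_sequence : Prop := IsDiagramSequence {
  incl_inj : forall r, injective (incl D r);
  cellular : forall r, is_cell_datum (cbasis D r) star;
  coefP : forall r, is_cell_coef (cbasis D r) (coef D r);
  star_incl : forall r (a : alg D r), star (incl D r a) = incl D r (star a);
  alg0 : bijective (fun k : R => k%:A : alg D 0);
  pt0_unique : forall lam : pt D 0, lam = pt0 D;
  delta_gen : forall r (lam : pt D r),
    generates_cell_mod (coef D r) (delta lam);
  cgenP : forall r (lam : pt D r),
    is_cell_generator (cbasis D r) (delta lam) (cgen lam);
  cgen0 : cgen (pt0 D) = 1;
  cgen_star : forall r (lam : pt D r), star (cgen lam) = cgen lam;
  generic_split_semisimple : forall r,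
    exists (AF : algType {fraction R}) (iota : {rmorphism alg D r -> AF}),
      is_base_change (@tofrac R) iota /\ split_semisimple AF;
  restriction_filtration : forall r (nu : pt D r.+1),
    exists n (lam : 'I_n -> pt D r), order_preserving_filtration nu lam;
  edgeP : forall r (l : pt D r) (nu : pt D r.+1),
    edge l nu <->
    exists n (lam : 'I_n -> pt D r),
      order_preserving_filtration nu lam /\ exists j, lam j = l;
  dbrP : forall r (nu : pt D r.+1), down_branching nu;
  ubr_exists : forall r (l : pt D r) (nu : pt D r.+1), edge l nu ->
    exists u : alg D r.+1,
      cgen nu * dbr l nu = star u * incl D r (cgen l)
}.

(* Sequences of vertices (t(0), ..., t(r)), as left-nested tuples. *)
Fixpoint vseq (r : nat) : finType :=
  if r is r'.+1 then (vseq r' * pt D r'.+1)%type else pt D 0.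

(* the last vertex t(r) *)
Definition tip (r : nat) : vseq r -> pt D r :=
  match r with 0 => fun t => t | r'.+1 => fun t => t.2 end.

Fixpoint is_path (r : nat) : vseq r -> bool :=
  match r with
  | 0 => fun=> true
  | r'.+1 => fun t => is_path t.1 && edge (tip t.1) t.2
  end.

Definition StdPath r (nu : pt D r) : finType :=
  {t : vseq r | is_path t && (tip t == nu)}.

(* d_t = d_{t(r-1) -> t(r)} ... d_{t(0) -> t(1)}, inside A_r *)
Fixpoint dpath (r : nat) : vseq r -> alg D r :=
  match r with
  | 0 => fun=> 1
  | r'.+1 => fun t => dbr (tip t.1) t.2 * incl D r' (dpath t.1)
  end.

Definition murphy r (lam : pt D r) (s t : vseq r) : alg D r :=
  star (dpath s) * cgen lam * dpath t.

Section Permissible.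

Variable perm : forall r, pt D r -> bool.

Fixpoint perm_path (r : nat) : vseq r -> bool :=
  match r with
  | 0 => fun t => perm (r := 0) t
  | r'.+1 => fun t => perm_path t.1 && perm t.2
  end.

(* t(k) is permissible for all k < r *)
Definition perm_below (r : nat) : vseq r -> bool :=
  match r with 0 => fun=> true | r'.+1 => fun t => perm_path t.1 end.

Definition marginal r (mu : pt D r) : Prop :=
  ~~ perm mu /\ exists t : StdPath mu, perm_below (val t).

Definition StdPerm r (nu : pt D r) : finType :=
  {t : vseq r | [&& is_path t, tip t == nu & perm_path t]}.

Definition perm_pt r : Type := {lam : pt D r | perm lam}.

HB.instance Definition _ r := Finite.on (perm_pt r).
HB.instance Definition _ r := SubFinite.on (perm_pt r).
HB.instance Definition _ r :=
  [SubChoice_isSubPOrder of perm_pt r by <: with pt_disp D].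

End Permissible.

End Diagram.

(* ----------------------------- Quotients -------------------------------- *)

(* K is {fraction S}.  [spA r] is A_r^S, [gnA r] is A_r^K, and the maps
   A_r -> A_r^S -> A_r^K are the canonical ones.  The inclusions and
   involutions of A_r^S and A_r^K are those induced from the ones of A_r.
   [QS r] is the S-subalgebra phi_r(A_r^S) of Q_r^K, given as an abstract
   S-algebra through the factorisation A_r^S ->> QS r >-> Q_r^K of phi_r. *)
Record quotient_data (R S : idomainType) (D : diagram_data R) := QuotientData {
  spA : nat -> algType S;
  gnA : nat -> algType {fraction S};
  toS : forall r, {rmorphism alg D r -> spA r};
  toK : forall r, {rmorphism spA r -> gnA r};
  inclS : forall r, {lrmorphism spA r -> spA r.+1};
  inclK : forall r, {lrmorphism gnA r -> gnA r.+1};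
  starS : forall r, {linear spA r -> spA r};
  starK : forall r, {linear gnA r -> gnA r};
  QK : nat -> algType {fraction S};
  inclQ : forall r, {lrmorphism QK r -> QK r.+1};
  phi : forall r, {lrmorphism gnA r -> QK r};
  QS : nat -> algType S;
  phiS : forall r, {lrmorphism spA r -> QS r};
  QS_val : forall r, {rmorphism QS r -> QK r};
  Kbar : closedFieldType;
  toKbar : {rmorphism {fraction S} -> Kbar};
  perm : forall r, pt D r -> bool;
  (* only the values at marginal points are meaningful *)
  bfrak : forall r, pt D r -> spA r;
  bfrak' : forall r, pt D r -> spA r;
  beta : forall r, pt D r -> gnA r
}.

Arguments spA {R S D} q r.
Arguments gnA {R S D} q r.
Arguments toS {R S D} q r.
Arguments toK {R S D} q r.
Arguments inclS {R S D} q r.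
Arguments inclK {R S D} q r.
Arguments starS {R S D} q r.
Arguments starK {R S D} q r.
Arguments QK {R S D} q r.
Arguments inclQ {R S D} q r.
Arguments phi {R S D} q r.
Arguments QS {R S D} q r.
Arguments phiS {R S D} q r.
Arguments QS_val {R S D} q r.
Arguments Kbar {R S D} q.
Arguments toKbar {R S D} q.
Arguments perm {R S D} q [r] lam.
Arguments bfrak {R S D} q [r] mu.
Arguments bfrak' {R S D} q [r] mu.
Arguments beta {R S D} q [r] mu.

Section Quotient.

Variables (R S : idomainType) (pi : {rmorphism R -> S}).
Variables (D : diagram_data R) (Q : quotient_data S D).

(* the image in A_r^K of an element of A_r *)
Definition imK r (a : alg D r) : gnA Q r := toK Q r (toS Q r a).

(* the kernel of phi_r on A_r^S *)
Definition ker_phi r (a : spA Q r) : Prop := phi Q r (toK Q r a) = 0.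

Record is_quotient_tower : Prop := IsQuotientTower {
  pi_surj : forall y : S, exists x : R, pi x = y;
  spA_base_change : forall r, is_base_change pi (toS Q r);
  gnA_base_change : forall r,
    is_base_change (fun k => tofrac (pi k)) (@imK r);
  toK_semilinear : forall r, semilinear_over (@tofrac S) (toK Q r);
  inclSE : forall r a, inclS Q r (toS Q r a) = toS Q r.+1 (incl D r a);
  inclKE : forall r a, inclK Q r (imK a) = imK (incl D r a);
  starSE : forall r (a : alg D r), starS Q r (toS Q r a) = toS Q r (star a);
  starKE : forall r (a : alg D r), starK Q r (imK a) = imK (star a);
  inclQ_inj : forall r, injective (inclQ Q r);
  phi_surj : forall r (y : QK Q r), exists x, phi Q r x = y;
  phi_incl : forall r x, phi Q r.+1 (inclK Q r x) = inclQ Q r (phi Q r x);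
  phiS_surj : forall r (y : QS Q r), exists x, phiS Q r x = y;
  QS_val_inj : forall r, injective (QS_val Q r);
  QS_valE : forall r x, QS_val Q r (phiS Q r x) = phi Q r (toK Q r x);
  Kbar_algebraic : forall x : Kbar Q, algebraicOver (toKbar Q) x;
  (* permissible points *)
  perm_pt0 : perm Q (pt0 D);
  perm_up : forall r (mu : pt D r), perm Q mu ->
    exists nu : pt D r.+1, perm Q nu /\ edge mu nu;
  perm_down : forall r (mu : pt D r.+1), perm Q mu ->
    exists lam : pt D r, perm Q lam /\ edge lam mu;
  (* the elements b_mu, b'_mu: the marginal points are exactly the first
     non-permissible vertices of the non-permissible paths *)
  cgen_split : forall r (mu : pt D r), marginal (perm Q) mu ->
    toS Q r (cgen mu) = bfrak Q mu - bfrak' Q mu;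
  bfrak_ker : forall r (mu : pt D r), marginal (perm Q) mu ->
    ker_phi (bfrak Q mu);
  bfrak'_cgen : forall r (mu : pt D r), marginal (perm Q) mu ->
    exists x : gnA Q r, toK Q r (bfrak' Q mu) = imK (cgen mu) * x;
  bfrak'_above : forall r (mu : pt D r), marginal (perm Q) mu ->
    above (fun lam s t => toS Q r (cbasis D r lam s t)) mu
      (bfrak' Q mu);
  betaP : forall r (mu : pt D r), marginal (perm Q) mu ->
    toK Q r (bfrak Q mu) = imK (cgen mu) * beta Q mu;
  dim_Q : forall r,
    exists (V : lmodType (Kbar Q)) (iota : QK Q r -> V),
      is_base_change (toKbar Q) iota /\
      has_dim V (\sum_(nu : pt D r | perm Q nu) #|StdPerm (perm Q) nu| ^ 2)
}.

(* a_t = d_t for t permissible; otherwise, k being the first index with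
   mu = t(k) not permissible, a_t = d_{t[k,r]} beta_mu d_{t[0,k]}.  The
   recursion removes the last edge: it yields beta_mu d_{t[0,k]} at level k
   and a factor d_{t(j-1) -> t(j)} at each level j > k.  (At level 0 the only
   vertex is permissible.) *)
Fixpoint apath (r : nat) : vseq D r -> gnA Q r :=
  match r with
  | 0 => fun=> 1
  | r'.+1 => fun t =>
      if perm_path (perm Q) t.1 then
        if perm Q t.2 then imK (dpath (r := r'.+1) t)
        else beta Q t.2 * imK (dpath (r := r'.+1) t)
      else imK (dbr (tip t.1) t.2) * inclK Q r' (apath t.1)
  end.

Definition mtilde r (lam : pt D r) (s t : vseq D r) : gnA Q r :=
  starK Q r (apath s) * imK (cgen lam) * apath t.

Definition kappa_index r : finType :=
  {i : {lam : pt D r & (StdPath lam * StdPath lam)%type} |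
     ~~ perm_path (perm Q) (val (tagged i).1) ||
     ~~ perm_path (perm Q) (val (tagged i).2)}.

Definition kappa r (i : kappa_index r) : gnA Q r :=
  mtilde (tag (val i)) (val (tagged (val i)).1) (val (tagged (val i)).2).

(* the images in A_r^S of the elements b_mu, mu marginal in level s,
   0 < s <= r *)
Inductive marginal_gen : forall r, spA Q r -> Prop :=
  | marginal_here r (mu : pt D r) :
      (0 < r)%N -> marginal (perm Q) mu -> marginal_gen (bfrak Q mu)
  | marginal_up r (x : spA Q r) : marginal_gen x -> marginal_gen (inclS Q r x).

Definition quotient_basis r (lam : perm_pt (perm Q) r)
    (s t : StdPerm (perm Q) (val lam)) : QS Q r :=
  phiS Q r (toS Q r (murphy (val lam) (val s) (val t))).

End Quotient.

(* Main.v *)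
(* The elements m_lam d_t triangulate the down-branching filtrations of the
   cell modules, so the Murphy elements d_s^* m_lam d_t form a basis of A_r,
   and of its base changes.  For a non-permissible path t one has
   m_lam a_t = m_lam d_t + (terms m_lam d_v with v above t) modulo higher
   cells, because b'_mu = m_mu x acts as zero on the cell module of mu.  Hence
   replacing d_t by a_t on one side yields another S-basis of A_r^S, whose
   elements with a non-permissible path lie in ker(phi_r) by (Q2); by (Q3) they
   span it.  For a non-permissible s paired with a permissible t this uses that
   ker(phi_(r-1)) is *-invariant, which is propagated to level r by descending
   induction on lam. *)

(* The kernel has no evident symmetry: (Q2) puts b_mu into it, but not its image under the
   involution. Without symmetry only products d_s^* m a_t with t non-permissible are visibly killed,
   which leaves out the pairs with t permissible and s not. The circle is broken by a drop in level.
   If t is permissible and s ends at the same vertex, then s leaves the permissible points before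
   its end, and the up-branching factors write m a_s as a multiple of the corresponding element one
   level down. So the count in (Q3) yields a basis of the kernel at level r before invariance at
   level r is known. Invariance is then checked on that basis, where the only new case is a path
   whose first non-permissible vertex is its last. The other difficulty is integrality: beta_mu
   lives over K and only m_mu beta_mu = b_mu is integral. Computations are made in A_r^K and return
   to A_r^S by comparing coefficients of Murphy elements, a basis of both. After base change no cell
   modules are formed; congruences modulo higher cells replace them. *)
From HB Require Import structures.
Require Import Defs.
Import Order.TTheory GRing.Theory.

Set Implicit Arguments.
Unset Strict Implicit.
Unset Printing Implicit Defensive.

(** * Spans modulo a submodule and unitriangular families *)

Section Span.
Variables (F : pzRingType) (V : lmodType F).

Definition submod (N : V -> Prop) : Prop :=
  N 0 /\ forall k x y, N x -> N y -> N (k *: x + y).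

Section Submod.
Variables (N : V -> Prop) (hN : submod N).

Lemma submod0 : N 0. Proof. exact: hN.1. Qed.

Lemma submodD x y : N x -> N y -> N (x + y).
Proof. by move=> hx hy; rewrite -[x]scale1r; apply: hN.2. Qed.

Lemma submodZ k x : N x -> N (k *: x).
Proof. by move=> hx; rewrite -[_ *: _]addr0; apply: hN.2 => //;
  exact: hN.1. Qed.

Lemma submodN x : N x -> N (- x).
Proof. by rewrite -scaleN1r; exact: submodZ. Qed.

Lemma submodB x y : N x -> N y -> N (x - y).
Proof. by move=> hx /submodN; exact: submodD. Qed.

Lemma submod_sum (I : finType) (P : pred I) (G : I -> V) :
  (forall i, P i -> N (G i)) -> N (\sum_(i | P i) G i).
Proof. by move=> hG; apply: big_ind => //;
  [exact: submod0 | exact: submodD]. Qed.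

End Submod.

Variable I : finType.
Implicit Types (U : pred I) (b : I -> V).

Definition spn U b (x : V) : Prop :=
  exists k : I -> F, x = \sum_(i | U i) k i *: b i.

Definition lfree U b : Prop :=
  forall k : I -> F, \sum_(i | U i) k i *: b i = 0 -> forall i, U i -> k i = 0.

Lemma spn_submod U b : submod (spn U b).
Proof.
split; first by exists (fun=> 0); rewrite big1 // => i _; rewrite scale0r.
move=> a _ _ [k ->] [l ->]; exists (fun i => a * k i + l i).
rewrite scaler_sumr -big_split; apply: eq_bigr => i _ /=.
by rewrite scalerDl scalerA.
Qed.

Lemma spn_gen U b i : U i -> spn U b (b i).
Proof.
move=> Ui; exists (fun j => (j == i)%:R).
rewrite (bigD1 i) //= eqxx scale1r big1 ?addr0 // => j /andP[_ /negPf->].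
by rewrite scale0r.
Qed.

Lemma spn_min U b (N : V -> Prop) : submod N ->
  (forall i, U i -> N (b i)) -> forall x, spn U b x -> N x.
Proof.
move=> hN hb x [k ->]; apply: submod_sum => // i /hb.
exact: submodZ.
Qed.

Lemma spn_mono U U' b x : (forall i, U i -> U' i) -> spn U b x -> spn U' b x.
Proof.
by move=> h; apply: spn_min => [|i /h]; [exact: spn_submod | exact: spn_gen].
Qed.

Lemma lfree_disjoint U U' b x : lfree U b -> (forall i, U' i -> U i) ->
  forall k, x = \sum_(i | U i) k i *: b i -> spn U' b x ->
  forall i, U i -> ~~ U' i -> k i = 0.
Proof.
move=> fb sU k -> [l] /eqP; rewrite -subr_eq0 => /eqP h i Ui nU.
have := fb (fun i => k i - (if U' i then l i else 0)).
move=> /(_ _ i Ui); rewrite (negPf nU) subr0; apply.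
rewrite -[RHS]h; under eq_bigr do rewrite scalerBl.
rewrite sumrB; congr (_ - _); rewrite [RHS]big_mkcond /= [LHS]big_mkcond /=.
apply: eq_bigr => j _; have := sU j; case: (U' j) => [->//|_].
by case: ifP; rewrite ?scale0r.
Qed.

Definition spn_mod (N : V -> Prop) U b (x : V) : Prop :=
  exists k : I -> F, N (x - \sum_(i | U i) k i *: b i).

Section SpanModulo.
Variables (N : V -> Prop) (hN : submod N).

Lemma spn_mod_submod U b : submod (spn_mod N U b).
Proof.
split.
  exists (fun=> 0); rewrite big1 ?subr0; first exact: submod0.
  by move=> w _; rewrite scale0r.
move=> a x y [k hk] [l hl]; exists (fun w => a * k w + l w).
under eq_bigr do rewrite scalerDl -scalerA.
rewrite big_split /= -scaler_sumr opprD addrACA -scalerBr.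
exact: hN.2.
Qed.

Lemma spn_mod_sub U b x : N x -> spn_mod N U b x.
Proof. by exists (fun=> 0); rewrite big1 ?subr0 // => i _; rewrite scale0r. Qed.

Lemma spn_mod_gen U b i : U i -> spn_mod N U b (b i).
Proof.
by move=> Ui; have [k {1}->] := spn_gen b Ui; exists k; rewrite subrr;
  exact: submod0.
Qed.

Lemma spn_mod_min U b (N' : V -> Prop) : submod N' ->
  (forall x, N x -> N' x) -> (forall i, U i -> N' (b i)) ->
  forall x, spn_mod N U b x -> N' x.
Proof.
move=> hN' hu hb x [k /hu h]; rewrite -[x](subrK (\sum_(i | U i) k i *: b i)).
by apply: submodD => //; apply: submod_sum => // i /hb; exact: submodZ.
Qed.

End SpanModulo.

Section Unitriangular.
(* [gt i j]: [j] is above [i] *)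
Variables (gt : rel I) (P : pred I) (c e : I -> V).
Hypotheses (gt_irr : irreflexive gt) (gt_trans : transitive gt).
Hypothesis tri : forall i, P i -> spn (fun j => P j && gt i j) c (e i - c i).

(** Stated for every up-closed [U], not only for [P]: it is later applied to the pairs above a
    point, where it says that a triangular change of basis preserves the cell ideals. *)
Lemma unitri_spn U : (forall i, U i -> P i) ->
  (forall i j, U i -> P j -> gt i j -> U j) ->
  forall x, spn U e x <-> spn U c x.
Proof.
move=> UP Uup x; split.
  apply: spn_min => [|i Ui]; first exact: spn_submod.
  rewrite -[e i](subrK (c i)); apply: submodD; first exact: spn_submod.
    apply: spn_mono (tri (UP _ Ui)) => j /andP[Pj gij]; exact: Uup gij.
  exact: spn_gen.
apply: spn_min => [|i]; first exact: spn_submod.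
(* Induction on the number of indices above [i]. It drops for [j] above [i], since [j] is above [i]
   but not above itself. *)
elim: {i}_.+1 {-2}i (ltnSn #|gt i|) => // n IH i lin Ui.
rewrite -[c i](subKr (e i)); apply: submodB; first exact: spn_submod.
  exact: spn_gen.
apply: spn_min (tri (UP _ Ui)) => [|j /andP[Pj gij]]; first exact: spn_submod.
apply: IH; last exact: Uup gij.
rewrite -ltnS; apply: leq_trans lin; rewrite ltnS; apply: proper_card.
apply/properP; split; first by apply/subsetP => k; exact: gt_trans.
by exists j => //; rewrite -topredE /= gt_irr.
Qed.

(** When a relation is expanded in [c], the coefficient of [c i] is [k i] plus multiples of those
    [k j] for which [i] is above [j]. Hence the coefficients vanish one after the other, from the
    bottom of the order. *)
Lemma unitri_lfree : lfree P c -> lfree P e.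
Proof.
move=> fc k hk.
have [p hp] : exists p : I -> I -> F, forall i, P i ->
    e i = \sum_(j | P j) p i j *: c j /\
    forall j, P j -> p i j = (if gt i j then p i j else (i == j)%:R).
  have : forall i, exists p : {ffun I -> F}, P i ->
    e i = \sum_(j | P j) p j *: c j /\
    forall j, P j -> p j = (if gt i j then p j else (i == j)%:R).
    move=> i; case Pi: (P i); last by exists [ffun=> 0].
    have [q hq] := tri Pi.
    exists [ffun j => if gt i j then q j else (i == j)%:R] => _.
    split => [|j Pj]; last by rewrite ffunE; case: ifP.
    rewrite -[e i](subrK (c i)) hq [RHS](bigID (gt i)) /=; congr (_ + _).
      by apply: eq_bigr => j /andP[_ gij]; rewrite ffunE gij.
    rewrite (bigD1 i) ?Pi ?gt_irr //= ffunE gt_irr eqxx scale1r big1 ?addr0 //.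
    move=> j /andP[/andP[_ /negPf gij] /negPf ji].
    by rewrite ffunE gij eq_sym ji scale0r.
  by move=> /fin_all_exists[p hp]; exists (fun i => p i).
have {}hk j : P j -> \sum_(i | P i) k i * p i j = 0.
  move: j; apply: fc; rewrite -[RHS]hk; under eq_bigr do rewrite scaler_suml.
  rewrite exchange_big /=; apply: eq_bigr => i /hp[-> _].
  by rewrite scaler_sumr; apply: eq_bigr => j _; rewrite scalerA.
move=> i; elim: {i}_.+1 {-2}i (ltnSn #|[pred j | gt j i]|) => // n IH i lin Pi.
have := hk i Pi; rewrite (bigD1 i) //= big1 => [|j /andP[Pj ji]].
  by rewrite addr0 (hp i Pi).2 // gt_irr eqxx mulr1.
rewrite (hp j Pj).2 //; case: ifP => [gji|_]; last by rewrite (negPf ji) mulr0.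
rewrite IH ?mul0r //; rewrite -ltnS; apply: leq_trans lin; rewrite ltnS.
apply: proper_card; apply/properP; split.
  by apply/subsetP => l; rewrite !inE => glj; exact: gt_trans gji.
by exists j; rewrite ?inE ?gt_irr.
Qed.

End Unitriangular.

(** The coordinate functionals of a basis, as functions on the whole module. Coefficient families
    are taken in [{ffun I -> F}] so that [xchoose] can select one. *)
Lemma lfree_dual U b : lfree U b -> (forall x, spn U b x) ->
  exists g : I -> V -> F,
    (forall i, U i -> forall k x y, g i (k *: x + y) = k * g i x + g i y) /\
    (forall i j, U i -> U j -> g i (b j) = (i == j)%:R).
Proof.
move=> fb sb.
have ex x : exists k : {ffun I -> F}, x == \sum_(i | U i) k i *: b i.
  have [k ->] := sb x; exists [ffun i => k i]; apply/eqP.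
  by apply: eq_bigr => i _; rewrite ffunE.
pose g i x := xchoose (ex x) i.
have gE x : x = \sum_(i | U i) g i x *: b i := eqP (xchooseP (ex x)).
have gU x k : x = \sum_(i | U i) k i *: b i -> forall i, U i -> g i x = k i.
  move=> hx i Ui; apply/eqP; rewrite -subr_eq0; apply/eqP.
  apply: (fb (fun i => g i x - k i)) => //.
  under eq_bigr do rewrite scalerBl.
  by rewrite sumrB -gE -hx subrr.
exists g; split=> [i Ui k x y|i j Ui Uj].
  apply: (gU _ (fun i => k * g i x + g i y)) => //.
  rewrite {1}(gE x) {1}(gE y) scaler_sumr -big_split; apply: eq_bigr => j _ /=.
  by rewrite scalerDl scalerA.
apply: (gU _ (fun i => (i == j)%:R)) => //.
rewrite (bigD1 j) //= eqxx scale1r big1 ?addr0 // => l /andP[_ /negPf->].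
by rewrite scale0r.
Qed.

End Span.

Section Reindex.
Variables (F : pzRingType) (V : lmodType F) (I J : finType) (P : pred J).
Variables (h : I -> J) (b : J -> V).
Hypotheses (hinj : injective h) (hP : forall i, P (h i)).
Hypothesis hsurj : forall j, P j -> exists i, h i = j.

Lemma sum_reindex (G : J -> V) : \sum_(j | P j) G j = \sum_i G (h i).
Proof.
rewrite [RHS](partition_big h P) //=; apply: eq_bigr => j /hsurj[i <-].
by rewrite (eq_bigl (pred1 i)) ?big_pred1_eq // => i'; rewrite (inj_eq hinj).
Qed.

Lemma spn_reindex x : spn P b x -> spn predT (b \o h) x.
Proof. by move=> [k ->]; exists (k \o h); exact: sum_reindex. Qed.

Lemma lfree_reindex : lfree P b -> lfree predT (b \o h).
Proof.
move=> fb k hk i _.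
pose k' j := if [pick i | h i == j] is Some i then k i else 0.
have k'E i' : k' (h i') = k i'.
  rewrite /k'; case: pickP => [i''|/(_ i')]; last by rewrite eqxx.
  by move=> /eqP/hinj ->.
rewrite -k'E; apply: fb => //; rewrite sum_reindex -[RHS]hk.
by apply: eq_bigr => i' _; rewrite k'E.
Qed.

End Reindex.

(** * Cell modules *)

Section CellAlgebra.
Variables (R : idomainType) (A : algType R) (disp : Order.disp_t).
Variables (L : finPOrderType disp) (Std : L -> finType).
Variable c : forall lam, Std lam -> Std lam -> A.
Arguments c {lam} _ _.

Lemma cell_spanE (P : pred L) x :
  cell_span (@c) P x <-> spn (fun i => P (tag i)) (cell_family (@c)) x.
Proof.
have E (k : forall mu, Std mu -> Std mu -> R) :
  \sum_(mu | P mu) \sum_s \sum_t k mu s t *: c s t =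
  \sum_(i : {lam : L & (Std lam * Std lam)%type} | P (tag i))
     k (tag i) (tagged i).1 (tagged i).2 *: cell_family (@c) i.
  under eq_bigr do rewrite pair_big /=.
  rewrite (sig_big_dep _ (fun _ _ => true)
    (fun mu p => k mu p.1 p.2 *: c p.1 p.2)) /=.
  by apply: eq_bigl => i; rewrite andbT.
split=> [[k ->]|[k ->]].
  by exists (fun i => k (tag i) (tagged i).1 (tagged i).2); exact: E.
exists (fun mu s t => k (Tagged (fun l => (Std l * Std l)%type) (s, t))).
by rewrite E; apply: eq_bigr => -[mu [s t]] _.
Qed.

Lemma cell_span_submod (P : pred L) : submod (cell_span (@c) P).
Proof.
split; first by apply/cell_spanE; exact: submod0 (spn_submod _ _).
move=> k x y /cell_spanE hx /cell_spanE hy; apply/cell_spanE.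
exact: (spn_submod _ _).2.
Qed.

Lemma cell_span_gen (P : pred L) lam (s t : Std lam) :
  P lam -> cell_span (@c) P (c s t).
Proof.
move=> Pl; apply/cell_spanE.
exact: (spn_gen (U := fun i => P (tag i)) (cell_family (@c))
  (i := Tagged (fun l => (Std l * Std l)%type) (s, t))).
Qed.

Lemma cell_span_min (P : pred L) (N : A -> Prop) : submod N ->
  (forall lam (s t : Std lam), P lam -> N (c s t)) ->
  forall x, cell_span (@c) P x -> N x.
Proof.
move=> hN hc x /cell_spanE; apply: spn_min => // -[mu [s t]] /=; exact: hc.
Qed.

Lemma cell_span_mono (P P' : pred L) x : (forall l, P l -> P' l) ->
  cell_span (@c) P x -> cell_span (@c) P' x.
Proof.
move=> h; apply: cell_span_min => [|l s t /h Pl]; first exact: cell_span_submod.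
exact: cell_span_gen.
Qed.

Lemma is_basisP (I : finType) (V : lmodType R) (b : I -> V) :
  is_basis b <-> lfree predT b /\ (forall x, spn predT b x).
Proof.
split=> [[_ hb]|[fb sb]].
  split=> [k hk i _|x]; last first.
    by have [k [-> _]] := hb x Logic.I; exists k.
  have [k0 [_ hu]] := hb 0 Logic.I.
  have e1 : k0 = [ffun=> 0].
    apply: hu; rewrite /lin_comb big1 // => j _.
    by rewrite ffunE scale0r.
  have e2 : k0 = [ffun j => k j].
    apply: hu; rewrite -hk /lin_comb; apply: eq_bigr => j _.
    by rewrite ffunE.
  by have := congr1 (fun h : {ffun I -> R} => h i) (etrans (esym e2) e1);
    rewrite !ffunE.
split=> // x _; have [k ->] := sb x.
exists [ffun i => k i]; split=> [|l].
  by apply: eq_bigr => i _; rewrite ffunE.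
rewrite /lin_comb => h; apply/ffunP => i; rewrite ffunE; apply/eqP.
rewrite -subr_eq0; apply/eqP; apply: (fb (fun i => k i - l i)) => //.
under eq_bigr do rewrite scalerBl.
by rewrite sumrB h subrr.
Qed.

Variable star : A -> A.
Hypothesis hcell : is_cell_datum (@c) star.

Lemma cell_star_lin k x y : star (k *: x + y) = k *: star x + star y.
Proof. by have [[]] := hcell. Qed.

Lemma cell_starM x y : star (x * y) = star y * star x.
Proof. by have [[]] := hcell. Qed.

Lemma cell_starK x : star (star x) = x.
Proof. by have [[]] := hcell. Qed.

Lemma cell_starD x y : star (x + y) = star x + star y.
Proof. by rewrite -[x]scale1r cell_star_lin !scale1r. Qed.

Lemma cell_star0 : star 0 = 0.
Proof. by apply: (addrI (star 0)); rewrite -cell_starD !addr0. Qed.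

Lemma cell_starZ k x : star (k *: x) = k *: star x.
Proof. by rewrite -[k *: x]addr0 cell_star_lin cell_star0 addr0. Qed.

Lemma cell_starB x y : star (x - y) = star x - star y.
Proof. by rewrite -scaleN1r cell_starD cell_starZ scaleN1r. Qed.

Lemma cell_star_sum (I : finType) (P : pred I) (G : I -> A) :
  star (\sum_(i | P i) G i) = \sum_(i | P i) star (G i).
Proof.
by apply: (big_morph star cell_starD cell_star0).
Qed.

Lemma above_submod lam : submod (above (@c) lam).
Proof. exact: cell_span_submod. Qed.

Lemma submod_star (N : A -> Prop) : submod N -> submod (fun x => N (star x)).
Proof.
move=> hN; split; first by rewrite cell_star0; exact: submod0.
by move=> k x y hx hy; rewrite cell_star_lin; exact: hN.2.
Qed.

Lemma submod_mulr (N : A -> Prop) a : submod N -> submod (fun x => N (x * a)).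
Proof.
move=> hN; split; first by rewrite mul0r; exact: submod0.
by move=> k x y hx hy; rewrite mulrDl -scalerAl; exact: hN.2.
Qed.

Lemma above_star lam x : above (@c) lam x -> above (@c) lam (star x).
Proof.
apply: (cell_span_min (submod_star (above_submod lam))) => mu s t lmu.
have [_ _ _ hst] := hcell.
rewrite -(subrK (c t s) (star _)); apply: submodD; first exact: above_submod.
  by apply: cell_span_mono (hst _ s t) => nu; exact: lt_trans.
exact: cell_span_gen.
Qed.

Lemma above_mulr lam x a : above (@c) lam x -> above (@c) lam (x * a).
Proof.
apply: (cell_span_min (submod_mulr a (above_submod lam))) => mu s t lmu.
have [_ _ hr _] := hcell.
have [r hr'] := hr mu t a.
rewrite -(subrK (\sum_v r v *: c s v) (_ * _)).
apply: submodD; first exact: above_submod.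
  by apply: cell_span_mono (hr' s) => nu; exact: lt_trans.
apply: submod_sum; first exact: above_submod.
move=> v _; apply: submodZ; first exact: above_submod.
exact: cell_span_gen.
Qed.

Lemma above_mull lam x a : above (@c) lam x -> above (@c) lam (a * x).
Proof.
move=> hx; rewrite -[_ * _]cell_starK cell_starM; apply: above_star.
by apply: above_mulr; exact: above_star.
Qed.

Local Notation alpha := (alpha_inv (@c)).
Local Notation eqm lam x y := (above (@c) lam (x - y)).

Lemma eqm_sym lam x y : eqm lam x y -> eqm lam y x.
Proof. by rewrite -[y - x]opprB; apply: submodN; exact: above_submod. Qed.

Lemma eqm_trans lam x y z : eqm lam x y -> eqm lam y z -> eqm lam x z.
Proof.
by move=> h1 h2; rewrite -(subrKA y); apply: submodD => //; exact: above_submod.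
Qed.

Lemma alpha_linr lam (x y z : {ffun Std lam -> R^o}) k :
  alpha x (k *: y + z) = k *: alpha x y + alpha x z.
Proof.
rewrite /alpha_inv scaler_sumr -big_split; apply: eq_bigr => s _ /=.
rewrite scaler_sumr -big_split; apply: eq_bigr => t _ /=.
by rewrite !ffunE mulrDr scalerDl scalerA; congr (_ *: _ + _); exact: mulrCA.
Qed.

Lemma alpha_linl lam (x y z : {ffun Std lam -> R^o}) k :
  alpha (k *: y + z) x = k *: alpha y x + alpha z x.
Proof.
rewrite /alpha_inv scaler_sumr -big_split; apply: eq_bigr => s _ /=.
rewrite scaler_sumr -big_split; apply: eq_bigr => t _ /=.
by rewrite !ffunE mulrDl scalerDl scalerA; congr (_ *: _ + _); rewrite -mulrA.
Qed.

Lemma alpha_above_eq lam x y : above_eq (@c) lam (alpha (lam := lam) x y).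
Proof.
have hS := cell_span_submod (fun mu => (lam <= mu)%O).
apply: submod_sum => // s _; apply: submod_sum => // t _; apply: submodZ => //.
exact: cell_span_gen.
Qed.

(** Coordinates for the cellular basis. They turn congruences modulo higher cells into scalar
    identities: at [lam] they see only the cell of [lam], and on [alpha x y] they multiply the
    entries of the two vectors. *)
Lemma cell_dual : exists g : forall lam, Std lam -> Std lam -> A -> R,
  (forall lam (s t : Std lam) k x y, g lam s t (k *: x + y) = k * g lam s t x +
    g lam s t y)
  /\ (forall lam (s t : Std lam), forall x y : {ffun Std lam -> R^o},
       g lam s t (alpha x y) = x s * y t)
  /\ (forall lam (s t : Std lam) x,
       cell_span (@c) (fun mu => mu != lam) x -> g lam s t x = 0)
  /\ (forall x, x = \sum_lam \sum_s \sum_t g lam s t x *: c s t).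
Proof.
have [_ /is_basisP[fc sc] _ _] := hcell.
have [g [gl gd]] := lfree_dual fc sc.
pose T l s t := Tagged (fun l : L => (Std l * Std l)%type) (i := l) (s, t).
have gsub (lam : L) (s t : Std lam) : submod (fun x => g (T lam s t) x = 0).
  have g0 : g (T lam s t) 0 = 0.
    have := gl (T lam s t) isT 1 0 0; rewrite scaler0 addr0 mul1r => h.
    by apply: (addrI (g (T lam s t) 0)); rewrite addr0.
  by split=> // k x y hx hy; rewrite gl // hx hy mulr0 addr0.
have gD l s t x y : g (T l s t) (x + y) = g (T l s t) x + g (T l s t) y.
  by rewrite -[x]scale1r gl // mul1r scale1r.
have gZ l s t k x : g (T l s t) (k *: x) = k * g (T l s t) x.
  by rewrite -[_ *: _]addr0 gl // (submod0 (gsub l s t)) addr0.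
have gS (J : finType) l s t (G : J -> A) :
    g (T l s t) (\sum_j G j) = \sum_j g (T l s t) (G j).
  by apply: (big_morph _ (gD l s t) (submod0 (gsub l s t))).
exists (fun lam s t => g (T lam s t)); split; first by move=> *; exact: gl.
have gc l s t l' s' t' : g (T l s t) (c s' t') = (T l s t == T l' s' t')%:R.
  exact: (gd (T l s t) (T l' s' t')).
split=> [lam s t x y|]; last split.
- rewrite /alpha_inv gS (bigD1 s) //= gS (bigD1 t) //= gZ gc eqxx mulr1.
  rewrite !big1 ?addr0 // => [s' ns|t' nt].
    rewrite gS big1 // => t' _; rewrite gZ gc eq_Tagged /= xpair_eqE.
    by rewrite eq_sym (negPf ns) mulr0.
  by rewrite gZ gc eq_Tagged /= xpair_eqE [t == _]eq_sym (negPf nt) andbF mulr0.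
- move=> lam s t; apply: cell_span_min => [|mu s' t' nmu]; first exact: gsub.
  rewrite gc; case: eqP => // /(congr1 tag) /= e.
  by rewrite e eqxx in nmu.
move=> x; have [k hk] := sc x.
under eq_bigr do rewrite pair_big /=.
rewrite (sig_big_dep predT (fun _ _ => true)
    (fun mu p => g (T mu p.1 p.2) x *: c p.1 p.2)) /=.
rewrite [LHS]hk; apply: eq_big => [[mu [s t]]|[mu [s t]] _] //=.
congr (_ *: _); rewrite hk gS (bigD1 (T mu s t)) //= big1 ?addr0.
  by rewrite gZ gc eqxx mulr1.
move=> [mu' [s' t']] ne; rewrite gZ gc eq_sym.
by rewrite (negPf ne) mulr0.
Qed.

(** At an index [s] with [x s != 0], the coordinate [x s * y t] vanishes because higher cells have
    no coordinate at [lam]; [R] is a domain, so [y t = 0]. *)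
Lemma alpha_inj0 lam (x y : {ffun Std lam -> R^o}) :
  x != 0 -> above (@c) lam (alpha x y) -> y = 0.
Proof.
move=> x0 h; have [g [_ [ga [g0 _]]]] := cell_dual.
have [s xs] : exists s, x s != 0.
  apply/existsP; apply: contraNT x0; rewrite negb_exists => /forallP hx.
  by apply/eqP/ffunP => s; rewrite ffunE; apply/eqP; have := hx s;
    rewrite negbK.
apply/ffunP => t; rewrite ffunE; apply/eqP.
have : g lam s t (alpha x y) = 0.
  apply: g0; apply: cell_span_mono h => mu.
  by rewrite lt_neqAle eq_sym => /andP[].
by rewrite ga => /eqP; rewrite mulf_eq0 (negPf xs).
Qed.

Variable coef : A -> forall lam, Std lam -> Std lam -> R.
Hypothesis hcoef : is_cell_coef (@c) coef.
Local Notation act x a := (cell_act coef x a : {ffun _ -> R^o}).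

Lemma alpha_mulr lam (x y : {ffun Std lam -> R^o}) a :
  eqm lam (alpha x y * a) (alpha x (act y a)).
Proof.
rewrite /alpha_inv mulr_suml -sumrB; apply: submod_sum => [|s _].
  exact: above_submod.
have -> : \sum_t (x s * act y a t) *: c s t =
  \sum_t (x s * y t) *: \sum_v coef a t v *: c s v.
  under [RHS]eq_bigr do rewrite scaler_sumr.
  rewrite exchange_big /=; apply: eq_bigr => v _; rewrite ffunE mulr_sumr.
  rewrite scaler_suml; apply: eq_bigr => t _.
  by rewrite scalerA mulrA.
rewrite mulr_suml -sumrB; apply: submod_sum => [|t _];
  first exact: above_submod.
rewrite -scalerAl -scalerBr; apply: submodZ; first exact: above_submod.
exact: hcoef.
Qed.

Lemma alpha_star lam (x y : {ffun Std lam -> R^o}) :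
  eqm lam (star (alpha x y)) (alpha y x).
Proof.
rewrite /alpha_inv cell_star_sum [X in _ - X]exchange_big -sumrB.
apply: submod_sum => [|s _]; first exact: above_submod.
rewrite cell_star_sum -sumrB; apply: submod_sum => [|t _];
  first exact: above_submod.
rewrite cell_starZ mulrC -scalerBr; apply: submodZ; first exact: above_submod.
by have [_ _ _] := hcell.
Qed.

(** The left action on the first tensor factor is the right action conjugated by the involution,
    which exchanges the two factors and preserves the higher cells. *)
Lemma alpha_starl lam (x y : {ffun Std lam -> R^o}) a :
  eqm lam (star a * alpha x y) (alpha (act x a) y).
Proof.
apply: eqm_trans (alpha_star _ _).
apply: eqm_trans (_ : eqm lam _ (star (alpha y x * a))) _.
  rewrite cell_starM -mulrBr; apply: above_mull; apply: eqm_sym;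
    exact: alpha_star.
by rewrite -cell_starB; apply: above_star; exact: alpha_mulr.
Qed.

(* An element of the cell module is determined by its image under alpha, so
   the module axioms are inherited from the multiplication of the algebra. *)
Lemma ffun_eq_above lam (y z : {ffun Std lam -> R^o}) :
  (forall x, x != 0 -> eqm lam (alpha x y) (alpha x z)) -> y = z.
Proof.
(* With an empty index set there is no nonzero [x] to test with, but then the module is zero. *)
move=> h; have [/existsP[s _]|] := boolP [exists s : Std lam, true]; last first.
  by rewrite negb_exists => /forallP hs; apply/ffunP => s; have := hs s.
pose e : {ffun Std lam -> R^o} := [ffun t => (t == s)%:R].
have e0 : e != 0.
  apply: contraTneq isT => /(congr1 (fun f : {ffun Std lam -> R^o} => f s)).
  by rewrite !ffunE eqxx => /eqP; rewrite oner_eq0.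
apply/eqP; rewrite -subr_eq0; apply/eqP; apply: (alpha_inj0 e0).
rewrite addrC -scaleN1r alpha_linr scaleN1r addrC; exact: h.
Qed.

Lemma act1 lam (x : {ffun Std lam -> R^o}) : act x 1 = x.
Proof.
apply: ffun_eq_above => w _; apply: eqm_sym.
rewrite -[X in X - _]mulr1; exact: alpha_mulr.
Qed.

Lemma actM lam (x : {ffun Std lam -> R^o}) a b : act x (a * b) = act (act x a)
  b.
Proof.
apply: ffun_eq_above => w _.
apply: eqm_trans (eqm_sym (alpha_mulr _ _ _)) _.
apply: eqm_trans (alpha_mulr _ _ _).
by rewrite mulrA -mulrBl; apply: above_mulr; exact: alpha_mulr.
Qed.

Lemma act_linr lam (x : {ffun Std lam -> R^o}) k a b :
  act x (k *: a + b) = k *: act x a + act x b.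
Proof.
apply: ffun_eq_above => w _.
apply: eqm_trans (eqm_sym (alpha_mulr _ _ _)) _.
rewrite alpha_linr mulrDr -scalerAr opprD addrACA -scalerBr.
by apply: (above_submod _).2; exact: alpha_mulr.
Qed.

Lemma act_scalar lam (x : {ffun Std lam -> R^o}) k : act x k%:A = k *: x.
Proof.
have act_0 : act x 0 = 0.
  have := act_linr x 1 0 0; rewrite scaler0 addr0 scale1r => h.
  by apply: (addrI (act x 0)); rewrite addr0.
by rewrite -[_%:A]addr0 act_linr act1 act_0 addr0.
Qed.

Lemma cgen_mulr lam d m a : is_cell_generator (@c) (lam := lam) d m ->
  eqm lam (m * a) (alpha d (act d a)).
Proof.
move=> [_ hm]; apply: eqm_trans (alpha_mulr _ _ _).
by rewrite -mulrBl; exact: above_mulr.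
Qed.

(** With [a] and [b] path products, this identifies a Murphy element with a pure tensor of path
    vectors, so that bases of the cell modules give a basis of the algebra. *)
Lemma cgen_mul lam d m a b : is_cell_generator (@c) (lam := lam) d m ->
  eqm lam (star a * m * b) (alpha (act d a) (act d b)).
Proof.
move=> hm; apply: eqm_trans (alpha_starl _ _ _).
by rewrite -mulrA -mulrBr; apply: above_mull; exact: cgen_mulr.
Qed.

End CellAlgebra.

(** * The Murphy basis over R *)

Section Murphy.
Variables (R : idomainType) (D : diagram_data R) (hD : is_diagram_sequence D).

Local Notation mod lam := {ffun std lam -> R^o}.

(** A predicate on vertex sequences instead of the sigma type [StdPath]: a sequence can then be
    extended by a vertex inside a sum without transporting proofs. *)
Definition path_to r (nu : pt D r) : pred (vseq D r) :=
  fun w => is_path w && (tip w == nu).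

(** The action [act], retyped with values in [R^o] so that the vectors carry their module structure
    over [R]. *)
Definition ract r (lam : pt D r) (x : mod lam) (a : alg D r) : mod lam :=
  act x a.

Lemma ract_linr r (lam : pt D r) (x : mod lam) k a b :
  ract x (k *: a + b) = k *: ract x a + ract x b.
Proof. exact: (act_linr (cellular hD r) (@coefP _ _ hD r)). Qed.

Lemma ract1 r (lam : pt D r) (x : mod lam) : ract x 1 = x.
Proof. exact: (act1 (cellular hD r) (@coefP _ _ hD r)). Qed.

Lemma ractM r (lam : pt D r) (x : mod lam) a b :
  ract x (a * b) = ract (ract x a) b.
Proof. exact: (actM (cellular hD r) (@coefP _ _ hD r)). Qed.

Lemma ract_scalar r (lam : pt D r) (x : mod lam) k : ract x k%:A = k *: x.
Proof. exact: (act_scalar (cellular hD r) (@coefP _ _ hD r)). Qed.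

Lemma ractB r (lam : pt D r) (x : mod lam) a b :
  ract x (a - b) = ract x a - ract x b.
Proof. by rewrite addrC -scaleN1r ract_linr scaleN1r addrC. Qed.

Definition ypath r (lam : pt D r) (w : vseq D r) : mod lam :=
  ract (delta lam) (dpath w).

(** * Path vectors along one down-branching filtration *)

Section Filtration.
Variables (r : nat) (nu : pt D r.+1) (n : nat) (lam : 'I_n -> pt D r).
Variables (M : nat -> mod nu -> Prop) (f : forall j : 'I_n, mod nu -> mod (lam
  j)).
Hypothesis hdec : decreasing lam.
Hypothesis hedge : forall l, edge l nu <-> exists j, lam j = l.
Hypothesis hfil : cell_filtration (lam := lam) M f.
Hypothesis hdbr : forall j : 'I_n, M j.+1 (ract (delta nu) (dbr (lam j) nu)) /\
   f j (ract (delta nu) (dbr (lam j) nu)) = delta (lam j).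

(** Restricted submodules are only closed under sums and the action; scalars come for free because
    [k%:A] acts as multiplication by [k]. *)
Let Msub j : (j <= n)%N -> submod (M j).
Proof.
have [_ _ hM _ _] := hfil; move=> /hM[h0 hD' hA]; split=> // k x y hx hy.
apply: hD' => //; have := hA x k%:A hx.
by rewrite rmorph_alg -/(ract _ _) ract_scalar.
Qed.

Let fD (j : 'I_n) x y : M j.+1 x -> M j.+1 y -> f j (x + y) = f j x + f j y.
Proof. by have [_ _ _ _ /(_ j)[h _ _ _]] := hfil; exact: h. Qed.

Let fA (j : 'I_n) x a : M j.+1 x ->
  f j (ract x (incl D r a)) = ract (f j x) a.
Proof. by have [_ _ _ _ /(_ j)[_ h _ _]] := hfil; exact: h. Qed.

Let fZ (j : 'I_n) k x : M j.+1 x -> f j (k *: x) = k *: f j x.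
Proof. by move=> hx; have := fA k%:A hx; rewrite rmorph_alg !ract_scalar. Qed.

Let f0 (j : 'I_n) x : M j.+1 x -> (f j x = 0 <-> M j x).
Proof. by have [_ _ _ _ /(_ j)[_ _ _ h]] := hfil; exact: h. Qed.

Let fsum (j : 'I_n) (P : pred (vseq D r)) (G : vseq D r -> mod nu) k :
  (forall v, P v -> M j.+1 (G v)) ->
  f j (\sum_(v | P v) k v *: G v) = \sum_(v | P v) k v *: f j (G v).
Proof.
move=> hG; have hM := Msub (ltn_ord j).
(* Since [f j] is additive only on [M j.+1], membership of the partial sums is carried along with
   their values. *)
have [] : M j.+1 (\sum_(v | P v) k v *: G v) /\
  f j (\sum_(v | P v) k v *: G v) = \sum_(v | P v) k v *: f j (G v); last by [].
apply: (big_rec2 (fun x y => M j.+1 x /\ f j x = y)).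
  split; first exact: submod0.
  by apply/f0; [exact: submod0 | apply: submod0; apply: Msub; exact: ltnW].
move=> v x y Pv [hx <-]; have hkG : M j.+1 (k v *: G v).
  by apply: submodZ => //; exact: hG.
by split; [exact: submodD | rewrite fD // fZ //; exact: hG].
Qed.

Let Mmono i j x : (i <= j <= n)%N -> M i x -> M j x.
Proof.
elim: j => [|j IH]; first by rewrite leqn0 => /andP[/eqP->].
case/andP; rewrite leq_eqVlt => /orP[/eqP->//|ij] jn hx.
have [_ _ _ h _] := hfil; apply: (h (Ordinal jn)).
by apply: IH => //; rewrite -ltnS ij ltnW.
Qed.

(** The path product of [(v, nu)] is the branching factor followed by the product of [v]. As [f j]
    commutes with the smaller algebra and sends the branching vector to the generator, it sends one
    path vector to the other: path vectors lift those of the subquotients. *)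
Let y_in (j : 'I_n) (v : vseq D r) : tip v = lam j ->
  M j.+1 (ypath nu (v, nu)) /\ f j (ypath nu (v, nu)) = ypath (lam j) v.
Proof.
move=> hv; rewrite /ypath /= hv ractM; have [h1 h2] := hdbr j.
have [_ _ hM _ _] := hfil; have [_ _ hA] := hM _ (ltn_ord j).
by split; [exact: hA | rewrite fA // h2].
Qed.

Hypothesis hspan : forall (l : pt D r) (x : mod l), spn (path_to l) (ypath l) x.
Hypothesis hfree : forall (l : pt D r), lfree (path_to l) (@ypath r l).

Definition filt_paths (j : nat) : pred (vseq D r.+1) := fun w =>
  path_to nu w && [exists i : 'I_n, (i < j)%N && (lam i == tip w.1)].

Let path_lift (j : 'I_n) v : path_to (lam j) v -> path_to nu ((v, nu) : vseq D
  r.+1).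
Proof.
case/andP=> pv /eqP tv; rewrite /path_to /= pv eqxx tv !andbT.
by apply/hedge; exists j.
Qed.

Let filt_sub (j : 'I_n) x : M j.+1 x -> forall k,
  f j x = \sum_(v | path_to (lam j) v) k v *: ypath (lam j) v ->
  M j (x - \sum_(v | path_to (lam j) v) k v *: ypath nu (v, nu)).
Proof.
move=> hx k hk; have hM := Msub (ltn_ord j).
have hy v : path_to (lam j) v -> M j.+1 (ypath nu (v, nu)).
  by case/andP=> _ /eqP/y_in[].
have hS : M j.+1 (\sum_(v | path_to (lam j) v) k v *: ypath nu (v, nu)).
  by apply: submod_sum => // v /hy; exact: submodZ.
apply/f0; first exact: submodB.
rewrite -scaleN1r addrC fD ?fZ //; last exact: submodZ.
rewrite hk fsum // scaleN1r addrC; apply/eqP; rewrite subr_eq0; apply/eqP.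
by apply: eq_bigr => v /andP[_ /eqP/y_in[_ ->]].
Qed.

Let filt_span j x : (j <= n)%N -> (M j x <-> spn (filt_paths j) (@ypath r.+1
  nu) x).
Proof.
move=> jn; split; last first.
  apply: spn_min => [|w /andP[pw /existsP[i /andP[ij /eqP ti]]]];
    first exact: Msub.
  apply: (@Mmono i.+1); first by rewrite ij.
  move: pw; case: w ti => v w /= ti /andP[_ /= /eqP ->].
  by have [] := y_in (esym ti).
elim: j jn x => [|j IH] jn x hx.
  have [h _ _ _ _] := hfil; move/h: hx => ->; exact: submod0 (spn_submod _ _).
pose j' := Ordinal jn.
have [k hk] := hspan (f j' x); have := filt_sub (j := j') hx hk.
move=> /(IH (ltnW jn)) hs; rewrite -[x](subrK
  (\sum_(v | path_to (lam j') v) k v *: ypath nu (v, nu))).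
apply: submodD; first exact: spn_submod.
  apply: spn_mono hs => w /andP[pw /existsP[i /andP[ij ti]]].
  by rewrite /filt_paths pw; apply/existsP; exists i; rewrite ti ltnS (ltnW ij).
apply: submod_sum => [|v pv]; first exact: spn_submod.
apply: submodZ; first exact: spn_submod.
apply: spn_gen; rewrite /filt_paths (path_lift pv) /=.
by apply/existsP; exists j'; case/andP: pv => _ /eqP ->; rewrite ltnSn eqxx.
Qed.

Lemma filtration_span (x : mod nu) : spn (path_to nu) (@ypath r.+1 nu) x.
Proof.
have [_ h _ _ _] := hfil; have /filt_span := h x.
by move=> /(_ (leqnn _)); apply: spn_mono => w /andP[].
Qed.

(** Freeness is lifted through the filtration step by step. The points [lam j] are distinct because
    they strictly decrease, so each path belongs to exactly one subquotient. *)
Lemma filtration_free : lfree (path_to nu) (@ypath r.+1 nu).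
Proof.
have lam_inj : injective lam.
  move=> i j e; apply/val_inj/eqP; apply: contraT; rewrite neq_ltn.
  by case/orP=> /hdec; rewrite e ltxx.
suff H j : (j <= n)%N -> lfree (filt_paths j) (@ypath r.+1 nu).
  move=> k hk w hw; apply: (H n (leqnn _) k); last first.
    rewrite /filt_paths hw; case/andP: hw;
      case: w => v w /= /andP[_ ev] /eqP ew.
    rewrite ew in ev; have [i hi] := (hedge _).1 ev.
    by apply/existsP; exists i; rewrite hi ltn_ord eqxx.
  rewrite -[RHS]hk; apply: eq_bigl => -[v w0]; rewrite /filt_paths.
  case pw : (path_to _ _) => //=; case/andP: pw => /= /andP[_ ev] /eqP ew.
  rewrite ew in ev; have [i hi] := (hedge _).1 ev.
  by apply/existsP; exists i; rewrite hi ltn_ord eqxx.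
elim: j => [|j IH] jn k hk w.
  by case/andP=> _ /existsP[i]; rewrite ltn0.
(* [T] selects the paths through [lam j']. All others lie in [M j], which [f j'] kills; so [f j']
   turns the relation into one among path vectors of the previous level. *)
pose j' := Ordinal jn;
  pose T (w0 : vseq D r.+1) := tip w0.1 == lam j' :> pt D r.
have T_filt w' : filt_paths j.+1 w' && ~~ T w' = filt_paths j w'.
  rewrite /filt_paths /T; case: (path_to _ _) => //=.
  apply/andP/existsP => [[/existsP[i /andP[ij /eqP ti]] nT]|[i /andP[ij /eqP
    ti]]].
    exists i; rewrite ti eqxx andbT ltn_neqAle -ltnS ij andbT.
    by apply: contraNneq nT => e; rewrite -ti; apply/eqP; congr lam;
      exact: val_inj.
  split; first by apply/existsP; exists i; rewrite ti eqxx ltnS ltnW.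
  apply: contraTneq ij; rewrite -ti => /lam_inj ->; by rewrite ltnn.
have T_split (w' : vseq D r.+1) : filt_paths j.+1 w' && T w' ->
    exists2 v, w' = (v, nu) & path_to (lam j') v.
  case: w' => v w' /andP[/andP[/andP[/= /andP[pv _] /eqP ->] _] /= hT].
  by exists v => //; rewrite /path_to pv.
have T_in v : path_to (lam j') v -> filt_paths j.+1 (v, nu) && T (v, nu).
  move=> hv; rewrite /filt_paths (path_lift hv) /T /=.
  case/andP: hv => _ /eqP ->; rewrite eqxx andbT; apply/existsP; exists j'.
  by rewrite ltnSn eqxx.
have sumT : \sum_(w | filt_paths j.+1 w && T w) k w *: ypath nu w =
    \sum_(v | path_to (lam j') v) k (v, nu) *: ypath nu (v, nu).
  rewrite (reindex_onto (fun v : vseq D r => (v, nu)) fst) /=; last first.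
    by move=> w' /T_split[v ->].
  apply: eq_bigl => v; rewrite eqxx andbT; apply/idP/idP => [|/T_in //].
  by move=> /T_split[v' [->]].
have sumN : \sum_(w | filt_paths j.+1 w && ~~ T w) k w *: ypath nu w =
    \sum_(w | filt_paths j w) k w *: ypath nu w by exact: eq_bigl.
have MN : M j (\sum_(w | filt_paths j w) k w *: ypath nu w).
  by apply/(filt_span _ (ltnW jn)); exists k.
move: hk; rewrite (bigID T) /= sumT sumN => hk.
have kT v : path_to (lam j') v -> k (v, nu) = 0.
  move: v; apply: hfree; have /eqP := hk; rewrite addr_eq0 => /eqP e.
  have hv v : path_to (lam j') v -> M j.+1 (ypath nu (v, nu)).
    by case/andP=> _ /eqP tv; exact: (y_in (j := j') tv).1.
  transitivity (f j' (\sum_(v | path_to (lam j') v) k (v, nu) *: ypath nu (v,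
    nu))).
    rewrite (fsum (j := j')) //; apply: eq_bigr => v /andP[_ /eqP tv].
    by rewrite (y_in (j := j') tv).2.
  have hN : M j (\sum_(v | path_to (lam j') v) k (v, nu) *: ypath nu (v, nu)).
    by rewrite e; apply: submodN => //; apply: Msub; exact: ltnW.
  by apply/f0 => //; apply: (@Mmono j) => //; rewrite leqnSn.
move=> hw; case Tw : (T w).
  have [v -> hv] := T_split w (introT andP (conj hw Tw)); exact: kT.
apply: (IH (ltnW jn)); last by rewrite -T_filt hw Tw.
by move: hk; rewrite big1 ?add0r // => v /kT ->; rewrite scale0r.
Qed.

(** Both vectors have the same image in the subquotient of [l], so they differ by an element of the
    preceding filtration step. That step is spanned by paths through points of smaller index, and
    these are higher in the order. *)
Lemma filtration_core (l : pt D r) a k : edge l nu ->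
  ract (delta l) a = \sum_(v | path_to l v) k v *: ypath l v ->
  spn (fun w => path_to nu w && (l < tip w.1)%O) (@ypath r.+1 nu)
    (ract (delta nu) (dbr l nu * incl D r a) -
     \sum_(v | path_to l v) k v *: ypath nu (v, nu)).
Proof.
move=> /hedge[j <-] hk; have [h1 h2] := hdbr j.
have hM : M j.+1 (ract (delta nu) (dbr (lam j) nu * incl D r a)).
  rewrite ractM; have [_ _ hM _ _] := hfil; have [_ _ hA] := hM _ (ltn_ord j).
  exact: hA.
have := filt_sub (j := j) hM (k := k); rewrite {1}ractM fA // h2 => /(_ hk).
move=> /(filt_span _ (ltnW (ltn_ord j))); apply: spn_mono => w.
case/andP=> -> /existsP[i /andP[/hdec ij /eqP <-]]; exact: ij.
Qed.

End Filtration.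

(** A zero generator could not reach the constant vector 1, which is nonzero as soon as [std lam]
    has an element. *)
Lemma delta_neq0 r (lam : pt D r) (s : std lam) : (delta lam : mod lam) != 0.
Proof.
apply: contraTneq isT => h.
have [a] := delta_gen hD (lam := lam) [ffun=> 1].
move=> /(congr1 (fun g : Delta lam => g s)); rewrite !ffunE big1 => [|t _].
  by move/eqP; rewrite oner_eq0.
have -> : delta lam t = (0 : mod lam) t by rewrite -h.
by rewrite ffunE mul0r.
Qed.

Lemma ypath_basis r (lam : pt D r) :
  lfree (path_to lam) (@ypath r lam) /\
  forall x, spn (path_to lam) (@ypath r lam) x.
Proof.
elim: r lam => [|r IH] nu; last first.
  have [n [lam [hdec hedge [M [f [hfil hdbr]]]]]] := dbrP hD nu.
  have IHs l := (IH l).2; have IHf l := (IH l).1.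
  split; last exact: filtration_span hedge hfil hdbr IHs.
  exact: filtration_free hdec hedge hfil hdbr IHs IHf.
have y0 w : ypath nu w = delta nu by rewrite /ypath ract1.
have e1 : @path_to 0 nu =1 xpred1 nu by move=> w; rewrite /path_to.
split=> [k|x].
  rewrite (eq_bigl _ _ e1) big_pred1_eq y0 => hk w; rewrite e1 => /eqP ->.
  (* Otherwise the cellular basis at level 0 would be empty, as [nu] is the only point there, and 1
     would be 0. *)
  have [s _] : exists s : std nu, true.
    have [_ /is_basisP[_ /(_ 1)[l hl]] _ _] := cellular hD 0.
    have [/existsP[s _]|] := boolP [exists s : std nu, true]; first by exists s.
    rewrite negb_exists => /forallP hs.
    have ne mu : std (d := D) (r := 0) mu -> False.
      rewrite (pt0_unique hD mu) -(pt0_unique hD nu) => s; have := hs s; by [].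
    move: hl; rewrite big1 => [/eqP|[mu [s t]] _]; first by rewrite oner_eq0.
    by case: (ne _ s).
  have [t dt] : exists t, (delta nu : mod nu) t != 0.
    apply/existsP; apply: contraNT (delta_neq0 s).
    rewrite negb_exists => /forallP hs; apply/eqP/ffunP => t.
    by rewrite ffunE; apply/eqP; have := hs t; rewrite negbK.
  move: hk => /(congr1 (fun g : mod nu => g t)); rewrite !ffunE => /eqP.
  by rewrite mulf_eq0 (negPf dt) orbF => /eqP.
have [a ha] := delta_gen hD (lam := nu) x.
have [g _ gK] := alg0 hD; exists (fun=> g a).
by rewrite (eq_bigl _ _ e1) big_pred1_eq y0 -ract_scalar gK.
Qed.


(** * Murphy elements as a basis adapted to the cell ideals *)

Definition mpair r (p : vseq D r * vseq D r) : alg D r :=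
  murphy (tip p.1) p.1 p.2.

Definition path_pair r (p : vseq D r * vseq D r) : bool :=
  [&& is_path p.1, is_path p.2 & tip p.1 == tip p.2].

Definition pair_above r (lam : pt D r) (p : vseq D r * vseq D r) : bool :=
  path_pair p && (lam < tip p.1)%O.

Lemma path_pairP r (lam : pt D r) u v : path_to lam u -> path_to lam v ->
  path_pair (u, v) /\ tip u = lam.
Proof.
by rewrite /path_pair /= => /andP[-> /eqP ->] /andP[-> /eqP ->]; rewrite eqxx.
Qed.

Lemma mpair_alpha r (lam : pt D r) u v : tip u = lam ->
  above (cbasis D r) lam (mpair (u, v) -
    alpha_inv (cbasis D r) (ypath lam u) (ypath lam v)).
Proof.
move=> <-; rewrite /mpair /murphy /=.
exact: (cgen_mul (cellular hD r) (@coefP _ _ hD r) _ _ (cgenP hD (tip u))).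
Qed.

Lemma alpha_ypath r (lam : pt D r) (N : alg D r -> Prop) : submod N ->
  (forall u v, path_to lam u -> path_to lam v ->
     N (alpha_inv (cbasis D r) (ypath lam u) (ypath lam v))) ->
  forall x y : mod lam, N (alpha_inv (cbasis D r) x y).
Proof.
move=> hN h x y; have [_ sp] := ypath_basis lam.
have a0r (z : mod lam) : alpha_inv (cbasis D r) z (0 : mod lam) = 0.
  rewrite /alpha_inv big1 // => s _; rewrite big1 // => t _.
  by rewrite ffunE mulr0 scale0r.
have a0l (z : mod lam) : alpha_inv (cbasis D r) (0 : mod lam) z = 0.
  rewrite /alpha_inv big1 // => s _; rewrite big1 // => t _.
  by rewrite ffunE mul0r scale0r.
have hl z : submod (fun x : mod lam => N (alpha_inv (cbasis D r) x z)).
  split; first by rewrite a0l; exact: submod0.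
  by move=> k x1 x2 h1 h2; rewrite alpha_linl; exact: hN.2.
have hr z : submod (fun y : mod lam => N (alpha_inv (cbasis D r) z y)).
  split; first by rewrite a0r; exact: submod0.
  by move=> k x1 x2 h1 h2; rewrite alpha_linr; exact: hN.2.
apply: (spn_min (hl y) _ (sp x)) => u pu.
by apply: (spn_min (hr _) _ (sp y)) => v pv; exact: h.
Qed.

Lemma mpair_above_eq r (p : vseq D r * vseq D r) :
  above_eq (cbasis D r) (tip p.1) (mpair p).
Proof.
case: p => u v /=; rewrite -(subrK (alpha_inv (cbasis D r)
  (ypath (tip u) u) (ypath (tip u) v)) (mpair _)).
apply: submodD; first exact: cell_span_submod.
  by apply: cell_span_mono (mpair_alpha _ (erefl _)) => mu; exact: ltW.
exact: alpha_above_eq.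
Qed.

(** A cellular basis element is the image of two unit vectors under [alpha_inv]; expanding these in
    path vectors gives Murphy elements up to higher cells, which are covered by induction on the
    number of points above [lam]. *)
Lemma cbasis_mpair r (lam : pt D r) (s t : std lam) :
  spn (fun p => path_pair p && (lam <= tip p.1)%O) (@mpair r) (cbasis D r lam s
    t).
Proof.
elim: {lam}_.+1 {-2}lam (ltnSn #|[pred mu | (lam < mu)%O]|) s t => // n IH lam
  hn s t.
pose e s : mod lam := [ffun t => (t == s)%:R].
have -> : cbasis D r lam s t = alpha_inv (cbasis D r) (e s) (e t).
  rewrite /alpha_inv (bigD1 s) //= (bigD1 t) //= !ffunE !eqxx mulr1 scale1r.
  rewrite !big1 ?addr0 // => [s' /negPf ns|t' /negPf nt].
    by rewrite big1 // => t' _; rewrite ffunE ns mul0r scale0r.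
  by rewrite !ffunE nt mulr0 scale0r.
apply: alpha_ypath => [|u v pu pv]; first exact: spn_submod.
have [pp tu] := path_pairP pu pv.
rewrite -(subKr (mpair (u, v)) (alpha_inv _ _ _)).
apply: submodB; first exact: spn_submod.
  by apply: spn_gen; rewrite pp /= tu.
apply: cell_span_min (mpair_alpha _ tu); first exact: spn_submod.
move=> mu s' t' lmu; apply: spn_mono (IH mu _ s' t').
  by move=> p /andP[-> /(lt_le_trans lmu)/ltW].
rewrite -ltnS; apply: leq_trans hn; rewrite ltnS; apply: proper_card.
apply/properP; split; first by apply/subsetP => x; rewrite !inE;
  exact: lt_trans.
by exists mu; rewrite !inE ?ltxx.
Qed.

Lemma mpair_span r (x : alg D r) : spn (@path_pair r) (@mpair r) x.
Proof.
have [_ /is_basisP[_ sc] _ _] := cellular hD r.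
apply: (spn_min (spn_submod _ _) _ (sc x)) => -[lam [s t]] _.
by apply: spn_mono (cbasis_mpair s t) => p /andP[].
Qed.

Lemma aboveE r (lam : pt D r) x :
  above (cbasis D r) lam x <-> spn (pair_above lam) (@mpair r) x.
Proof.
split.
  apply: cell_span_min => [|mu s t lmu]; first exact: spn_submod.
  apply: spn_mono (cbasis_mpair s t) => p /andP[vp mup].
  by rewrite /pair_above vp (lt_le_trans lmu).
apply: spn_min => [|p /andP[_ lp]]; first exact: above_submod.
by apply: cell_span_mono (mpair_above_eq p) => mu; exact: lt_le_trans.
Qed.

(** Induction from the lowest points up. In a coordinate at [lam], pairs at lower points have zero
    coefficient already, and pairs at other points have no part in the cell of [lam]. What remains
    is a relation between tensors of path vectors, resolved by freeness in each factor in turn. *)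
Lemma mpair_free r : lfree (@path_pair r) (@mpair r).
Proof.
move=> k hk; have [g [gl [ga [g0 _]]]] := cell_dual (cellular hD r).
have g00 lam s t : g lam s t 0 = 0.
  have := gl lam s t 1 0 0; rewrite scaler0 addr0 mul1r => h.
  by apply: (addrI (g lam s t 0)); rewrite addr0.
have gD lam s t x y : g lam s t (x + y) = g lam s t x + g lam s t y.
  by rewrite -[x]scale1r gl mul1r scale1r.
have gZ lam s t c x : g lam s t (c *: x) = c * g lam s t x.
  by rewrite -[_ *: _]addr0 gl g00 addr0.
suff H lam p : path_pair p -> tip p.1 = lam -> k p = 0.
  by move=> p vp; exact: H vp (erefl _).
move: p; elim: {lam}_.+1 {-2}lam (ltnSn #|[pred mu | (mu < lam)%O]|) => // n IH
  lam hn.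
have {}IH p : path_pair p -> (tip p.1 < lam)%O -> k p = 0.
  move=> vp lp; apply: (IH (tip p.1)) => //.
  rewrite -ltnS; apply: leq_trans hn; rewrite ltnS; apply: proper_card.
  apply/properP; split.
    by apply/subsetP => x; rewrite !inE => /lt_trans; apply.
  by exists (tip p.1); rewrite !inE ?ltxx.
have E s t : \sum_(u | path_to lam u) \sum_(v | path_to lam v)
    k (u, v) * (ypath lam u s * ypath lam v t) = 0.
  transitivity (g lam s t (\sum_(p | path_pair p) k p *: mpair p)); last first.
    by rewrite hk.
  rewrite (big_morph _ (gD lam s t) (g00 lam s t)).
  rewrite pair_big_dep /= [RHS](bigID (fun p => tip p.1 == lam)) /=.
  rewrite [X in _ = _ + X]big1 ?addr0; last first.
    move=> p /andP[vp np]; rewrite gZ.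
    have [lp|nlp] := boolP (tip p.1 < lam)%O; first by rewrite IH ?mul0r.
    rewrite g0 ?mulr0 //; apply: cell_span_mono (mpair_above_eq p) => mu lmu.
    by apply: contraNneq nlp => e; rewrite lt_neqAle np /= -e.
  apply: eq_big => [[u v]|[u v] /andP[pu pv]] /=.
    rewrite /path_to /path_pair /=; case: (is_path u); case: (is_path v) => //=;
      rewrite ?andbF //.
    by apply/andP/andP => -[/eqP -> /eqP ->].
  have [_ tu] := path_pairP pu pv.
  rewrite gZ -(subrK (alpha_inv (cbasis D r) (ypath lam u) (ypath lam v))
    (mpair _)).
  rewrite gD ga g0 ?add0r //; apply: cell_span_mono (mpair_alpha _ tu) => mu.
  by rewrite lt_neqAle eq_sym => /andP[].
have [fy _] := ypath_basis lam.
have E1 u t : path_to lam u -> \sum_(v | path_to lam v) k (u, v) * ypath lam v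
  t = 0.
  move: u; apply: fy; apply/ffunP => s; rewrite sum_ffunE ffunE -[RHS](E s t).
  apply: eq_bigr => u _; rewrite ffunE /= [LHS]mulr_suml; apply: eq_bigr => v _.
  by rewrite -!mulrA; congr (_ * _); exact: mulrC.
move=> [u v] /and3P[/= pu pv /eqP e] tu.
have hu : path_to lam u by rewrite /path_to pu tu eqxx.
have hv : path_to lam v by rewrite /path_to pv -e tu eqxx.
apply: (fy (fun v => k (u, v))) => //; apply/ffunP => t.
rewrite sum_ffunE ffunE -[RHS](E1 u t hu); apply: eq_bigr => w _.
by rewrite ffunE.
Qed.

Lemma cgen_ract r (lam : pt D r) a (U : pred (vseq D r)) k :
  ract (delta lam) a = \sum_(w | U w) k w *: ypath lam w ->
  above (cbasis D r) lam (cgen lam * a - \sum_(w | U w) k w *: (cgen lam *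
    dpath w)).
Proof.
move=> hk; have hm := cgenP hD lam.
have C := cellular hD r; have K := @coefP _ _ hD r.
apply: eqm_trans (cgen_mulr C K _ hm) _; apply: eqm_sym.
have -> : cell_act (coef D r) (delta lam) a = ract (delta lam) a by [].
have -> : alpha_inv (cbasis D r) (delta lam) (ract (delta lam) a) =
    \sum_(w | U w) k w *: alpha_inv (cbasis D r) (delta lam) (ypath lam w).
  have ah : {morph alpha_inv (cbasis D r) (delta lam : mod lam) : x y / x + y}.
    by move=> x y; have := alpha_linr (cbasis D r) (delta lam : mod lam) x y 1;
      rewrite !scale1r.
  have a0 : alpha_inv (cbasis D r) (delta lam) (0 : mod lam) = 0.
    by apply: (addrI (alpha_inv (cbasis D r) (delta lam) (0 : mod lam)));
      rewrite -ah !addr0.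
  rewrite hk (big_morph _ ah a0); apply: eq_bigr => w _.
  by rewrite -[k w *: ypath lam w]addr0 alpha_linr a0 addr0.
rewrite -sumrB; apply: submod_sum => [|w _]; first exact: above_submod.
rewrite -scalerBr; apply: submodZ; first exact: above_submod.
exact: (cgen_mulr C K _ hm).
Qed.

(** The same [k] serves at level [r] and along every edge to level [r.+1]. Only congruences between
    algebra elements occur, so the statement passes to a base change coefficient by coefficient. *)
Lemma cgen_core r (l : pt D r) a : exists k,
  above (cbasis D r) l
    (cgen l * a - \sum_(v | path_to l v) k v *: (cgen l * dpath v)) /\
  forall nu : pt D r.+1, edge l nu -> exists k',
    above (cbasis D r.+1) nu (cgen nu * (dbr l nu * incl D r a) -
      \sum_(v | path_to l v) k v *: (cgen nu * dpath (r := r.+1) (v, nu)) -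
      \sum_(w | path_to nu w && (l < tip w.1)%O) k' w *: (cgen nu * dpath w)).
Proof.
have [_ /(_ (ract (delta l) a))[k hk]] := ypath_basis l.
exists k; split=> [|nu enu]; first exact: cgen_ract.
have [n [lam [hdec hedge [M [f [hfil hdbr]]]]]] := dbrP hD nu.
have IHs (l : pt D r) := (ypath_basis l).2.
have [k' hk'] := filtration_core hdec hedge hfil hdbr IHs enu hk.
exists k'.
have -> : cgen nu * (dbr l nu * incl D r a) -
  \sum_(v | path_to l v) k v *: (cgen nu * dpath (r := r.+1) (v, nu)) =
  cgen nu * (dbr l nu * incl D r a -
     \sum_(v | path_to l v) k v *: dpath (r := r.+1) (v, nu)).
  rewrite mulrBr mulr_sumr; congr (_ - _); apply: eq_bigr => v _.
  by rewrite scalerAr.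
apply: cgen_ract; rewrite -hk' ractB; congr (_ - _).
have ah : {morph ract (delta nu : mod nu) : x y / x + y}.
  by move=> x y; have := ract_linr (delta nu : mod nu) 1 x y; rewrite !scale1r.
have a0 : ract (delta nu : mod nu) 0 = 0.
  by apply: (addrI (ract (delta nu : mod nu) 0)); rewrite -ah !addr0.
rewrite (big_morph _ ah a0); apply: eq_bigr => v _.
by rewrite -[k v *: dpath _]addr0 ract_linr a0 addr0.
Qed.

End Murphy.

(** * Base change *)

Section BaseChangeBasis.
Variables (R F : pzRingType) (f : {rmorphism R -> F}).
Variables (M : lmodType R) (N : lmodType F) (iota : M -> N).
Hypothesis bc : is_base_change f iota.
Variables (I : finType) (P : pred I) (b : I -> M).
Hypotheses (fb : lfree P b) (sb : forall x, spn P b x).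

Lemma base_change_sum k :
  iota (\sum_(i | P i) k i *: b i) = \sum_(i | P i) f (k i) *: iota (b i).
Proof.
have [il _] := bc.
have i0 : iota 0 = 0.
  have := il 1 0 0; rewrite rmorph1 !scale1r !addr0 => h.
  by apply: (addrI (iota 0)); rewrite addr0 -h.
have iD : {morph iota : x y / x + y}.
  by move=> x y; have := il 1 x y; rewrite rmorph1 !scale1r.
rewrite (big_morph _ iD i0); apply: eq_bigr => i _.
by rewrite -[_ *: b i]addr0 il i0 addr0.
Qed.

(** The coordinate functionals, composed with [f], are semilinear and extend to [N], which gives
    freeness. The expansion [e] built from them agrees with the identity on the image of [iota];
    uniqueness in the universal property makes it the identity, which gives spanning. *)
Lemma base_change_basis :
  lfree P (iota \o b) /\ (forall x, spn P (iota \o b) x).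
Proof.
have [g [gl gd]] := lfree_dual fb sb.
have [il iu] := bc.
have ex i : exists h : {linear N -> F^o}, P i -> forall x, h (iota x) = f (g i
  x).
  case Pi: (P i); last by exists \0.
  have sg : semilinear_over f ((fun x => f (g i x)) : M -> F^o).
    by move=> k x y; rewrite gl // rmorphD rmorphM.
  by have [h [hh _]] := iu _ _ sg; exists h.
have [h hh] := fin_all_exists ex.
have hd i j : P i -> P j -> h i (iota (b j)) = (i == j)%:R.
  by move=> Pi Pj; rewrite hh // gd // rmorph_nat.
split=> [k hk i Pi|x].
  have := congr1 (h i) hk; rewrite linear0 linear_sum (bigD1 i) //= linearZ /=.
  rewrite hd // eqxx big1 ?addr0 => [|j /andP[Pj ji]]; first by move=> e;
    rewrite -[LHS]mulr1; exact: e.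
  by rewrite linearZ /= hd // eq_sym (negPf ji); exact: mulr0.
pose e (x : N) : N := \sum_(i | P i) (h i x : F) *: iota (b i).
have el : linear e.
  move=> k y z; rewrite /e scaler_sumr -big_split; apply: eq_bigr => i _ /=.
  by rewrite linearP scalerDl scalerA.
pose eL : {linear N -> N} := HB.pack e (GRing.isLinear.Build F N N *:%R e el).
have [h0 [_ hu]] := iu _ _ il.
have eE : eL =1 h0.
  apply: hu => y /=; have [k ->] := sb y; rewrite base_change_sum /e.
  apply: eq_bigr => i Pi; congr (_ *: _); rewrite -base_change_sum hh //.
  have gD : {morph g i : x y / x + y}.
    by move=> x1 x2; have := gl i Pi 1 x1 x2; rewrite scale1r mul1r.
  have g0 : g i 0 = 0 by apply: (addrI (g i 0)); rewrite -gD !addr0.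
  have gZ c x1 : g i (c *: x1) = c * g i x1 by rewrite -[_ *: _]addr0 gl // g0
    addr0.
  rewrite (big_morph _ gD g0) (bigD1 i) //= gZ gd // eqxx mulr1.
  rewrite big1 ?addr0 // => j /andP[Pj ji].
  by rewrite gZ gd // eq_sym (negPf ji) mulr0.
have idE : x = eL x by rewrite eE; apply: (hu idfun).
by exists (fun i => h i x : F); rewrite {1}idE.
Qed.

End BaseChangeBasis.

(** * Orders on paths and on pairs of paths *)

Section PathOrder.
Variables (R : idomainType) (D : diagram_data R).

(* [v] is above [t]: the order used to triangulate, which compares vertices
   from the last one down. *)
Fixpoint vabove (r : nat) : rel (vseq D r) :=
  match r with
  | 0 => fun _ _ => false
  | r'.+1 => fun t v =>
      (t.2 == v.2) && ((tip t.1 < tip v.1)%O || vabove t.1 v.1)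
  end.

Lemma vabove_tip r (t v : vseq D r) : vabove t v -> tip t = tip v.
Proof. by case: r t v => [|r] //= t v /andP[/eqP]. Qed.

Lemma vabove_irr r : irreflexive (@vabove r).
Proof. by elim: r => [|r IH] //= t; rewrite eqxx ltxx IH. Qed.

Lemma vabove_trans r : transitive (@vabove r).
Proof.
elim: r => [|r IH] //= v t w /andP[/eqP -> tv] /andP[/eqP -> vw].
rewrite eqxx /=; case/orP: tv => [tv|tv]; case/orP: vw => [vw|vw].
- by rewrite (lt_trans tv vw).
- by rewrite -(vabove_tip vw) tv.
- by rewrite (vabove_tip tv) vw.
by rewrite (IH _ _ _ tv vw) orbT.
Qed.

Definition veqabove r (t v : vseq D r) := (t == v) || vabove t v.

Lemma veqabove_trans r : transitive (@veqabove r).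
Proof.
move=> v t w /orP[/eqP -> //|tv] /orP[/eqP <-|vw];
  first by rewrite /veqabove tv orbT.
by rewrite /veqabove (vabove_trans tv vw) orbT.
Qed.

Lemma veqabove_anti r (t v : vseq D r) : veqabove t v -> veqabove v t -> t = v.
Proof.
move=> /orP[/eqP //|tv] /orP[/eqP //|vt].
by have := vabove_trans tv vt; rewrite vabove_irr.
Qed.

(** At a common point this is the strict product order, so that changing either path factor is
    triangular; all pairs at higher points count as above, which absorbs the higher cells. *)
Definition pabove r (p q : vseq D r * vseq D r) : bool :=
  (tip p.1 < tip q.1)%O ||
  [&& tip p.1 == tip q.1, veqabove p.1 q.1, veqabove p.2 q.2 & p != q].

Lemma pabove_irr r : irreflexive (@pabove r).
Proof. by move=> p; rewrite /pabove ltxx !eqxx !andbF. Qed.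

Lemma pabove_trans r : transitive (@pabove r).
Proof.
move=> q p s; rewrite /pabove.
case/orP=> [pq|/and4P[/eqP e1 p1 p2 npq]];
  case/orP=> [qs|/and4P[/eqP e2 q1 q2 nqs]].
- by rewrite (lt_trans pq qs).
- by rewrite -e2 pq.
- by rewrite e1 qs.
rewrite e1 e2 eqxx (veqabove_trans p1 q1) (veqabove_trans p2 q2) /=.
apply/orP; right; apply: contraNneq npq => e.
move: q1 q2 e p1 p2; rewrite [p]surjective_pairing [q]surjective_pairing.
rewrite [s]surjective_pairing /= => q1 q2 [-> ->] p1 p2.
by rewrite (veqabove_anti p1 q1) (veqabove_anti p2 q2).
Qed.

End PathOrder.

(** * Murphy elements after base change, used for both [S] and its fraction field *)

Section BaseChange.
Variables (R F : idomainType) (f : {rmorphism R -> F}).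
Variables (D : diagram_data R) (hD : is_diagram_sequence D).
Variables (B : nat -> algType F) (iota : forall r, {rmorphism alg D r -> B r}).
Hypothesis bc : forall r, is_base_change f (iota r).
Variables (inclB : forall r, {lrmorphism B r -> B r.+1}).
Variables (starB : forall r, {linear B r -> B r}).
Hypothesis inclBE : forall r a, inclB r (iota r a) = iota r.+1 (incl D r a).
Hypothesis starBE : forall r (a : alg D r), starB r (iota r a) = iota r (star
  a).

Definition mB r (p : vseq D r * vseq D r) : B r := iota r (mpair p).

Lemma mB_free r : lfree (@path_pair _ D r) (@mB r).
Proof. by have [] := base_change_basis (bc r) (mpair_free hD (r := r))
  (mpair_span hD (r := r)). Qed.

Lemma mB_span r (x : B r) : spn (@path_pair _ D r) (@mB r) x.
Proof. by have [] := base_change_basis (bc r) (mpair_free hD (r := r))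
  (mpair_span hD (r := r)). Qed.

(** Conditions that cut out a submodule need checking only on the image of [alg D r], because this
    image spans. *)
Lemma iota_ind r (N : B r -> Prop) : submod N -> (forall a, N (iota r a)) ->
  forall x, N x.
Proof. by move=> hN h x; apply: (spn_min hN _ (mB_span x)) => p _;
  exact: h. Qed.

Lemma iotaZ r k (a : alg D r) : iota r (k *: a) = f k *: iota r a.
Proof. by have [il _] := bc r; rewrite -[k *: a]addr0 il rmorph0 addr0. Qed.

Lemma submod_iota r (N : B r -> Prop) : submod N -> submod (fun a => N (iota r
  a)).
Proof.
move=> hN; split; first by rewrite rmorph0; exact: submod0.
by move=> k x y hx hy; rewrite rmorphD iotaZ; exact: hN.2.
Qed.

Lemma submod_lin r q (g : {linear B r -> B q}) (N : B q -> Prop) :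
  submod N -> submod (fun x => N (g x)).
Proof.
move=> hN; split; first by rewrite linear0; exact: submod0.
by move=> k x y hx hy; rewrite linearP; exact: hN.2.
Qed.

Lemma submod_mull r (N : B r -> Prop) a : submod N -> submod (fun x => N (a *
  x)).
Proof.
move=> hN; split; first by rewrite mulr0; exact: submod0.
by move=> k x y hx hy; rewrite mulrDr -scalerAr; exact: hN.2.
Qed.

Lemma starB_mul r (x y : B r) : starB r (x * y) = starB r y * starB r x.
Proof.
move: x; apply: iota_ind => [|a].
  split=> [|k x1 x2 h1 h2]; first by rewrite mul0r linear0 mulr0.
  by rewrite mulrDl -scalerAl !linearP mulrDr -scalerAr h1 h2.
move: y; apply: iota_ind => [|b].
  split=> [|k x1 x2 h1 h2]; first by rewrite mulr0 linear0 mul0r.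
  by rewrite mulrDr -scalerAr !linearP mulrDl -scalerAl h1 h2.
by rewrite -rmorphM !starBE (cell_starM (cellular hD r)) rmorphM.
Qed.

Lemma starB_invol r (x : B r) : starB r (starB r x) = x.
Proof.
move: x; apply: iota_ind => [|a].
  by split=> [|k x1 x2 h1 h2]; rewrite ?linear0 // !linearP h1 h2.
by rewrite !starBE (cell_starK (cellular hD r)).
Qed.

Lemma starB_incl r (x : B r) : starB r.+1 (inclB r x) = inclB r (starB r x).
Proof.
move: x; apply: iota_ind => [|a].
  split=> [|k x1 x2 h1 h2]; first by rewrite !linear0.
  by rewrite !linearP h1 h2.
by rewrite inclBE !starBE inclBE (star_incl hD).
Qed.

(** The base change of the ideal of strictly higher cells, described by Murphy elements so that
    [mB_free] can compare coefficients. *)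
Definition up r (lam : pt D r) (x : B r) : Prop := spn (pair_above lam) (@mB r)
  x.

Lemma up_submod r (lam : pt D r) : submod (up lam).
Proof. exact: spn_submod. Qed.

Lemma up_iota r (lam : pt D r) a : above (cbasis D r) lam a -> up lam (iota r
  a).
Proof.
move/(aboveE hD); move: a; apply: spn_min => [|p hp].
  by apply: submod_iota; exact: up_submod.
exact: spn_gen.
Qed.

Lemma up_above r (lam : pt D r) x :
  above (fun lam s t => iota r (cbasis D r lam s t)) lam x -> up lam x.
Proof.
apply: cell_span_min => [|mu s t lmu]; first exact: up_submod.
by apply: up_iota; exact: cell_span_gen.
Qed.

Lemma mB_above r (p : vseq D r * vseq D r) (lam : pt D r) : pair_above lam p ->
  above (cbasis D r) lam (mpair p).
Proof. by move=> hp; apply/(aboveE hD); exact: spn_gen. Qed.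

Lemma up_mull r (lam : pt D r) a x : up lam x -> up lam (a * x).
Proof.
move: x; apply: spn_min => [|p hp]; first exact: submod_mull (up_submod lam).
move: a; apply: iota_ind => [|a]; first exact: submod_mulr (up_submod lam).
rewrite -rmorphM; apply: up_iota; apply: (above_mull (cellular hD r)).
exact: mB_above.
Qed.

Lemma up_mulr r (lam : pt D r) a x : up lam x -> up lam (x * a).
Proof.
move: x; apply: spn_min => [|p hp]; first exact: submod_mulr (up_submod lam).
move: a; apply: iota_ind => [|a]; first exact: submod_mull (up_submod lam).
rewrite -rmorphM; apply: up_iota; apply: (above_mulr (cellular hD r)).
exact: mB_above.
Qed.

Lemma up_star r (lam : pt D r) x : up lam x -> up lam (starB r x).
Proof.
move: x; apply: spn_min => [|p hp]; first exact: submod_lin (up_submod lam).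
rewrite starBE; apply: up_iota; apply: (above_star (cellular hD r)).
exact: mB_above.
Qed.

Definition cB r (lam : pt D r) : B r := iota r (cgen lam).
Definition dB r (w : vseq D r) : B r := iota r (dpath w).

Lemma cB_star r (lam : pt D r) : starB r (cB lam) = cB lam.
Proof. by rewrite starBE (cgen_star hD). Qed.

Lemma mBE r (u v : vseq D r) (lam : pt D r) : tip u = lam ->
  mB (u, v) = starB r (dB u) * cB lam * dB v.
Proof. by move=> <-; rewrite /mB /mpair /murphy /= !rmorphM starBE. Qed.

Lemma mB_star r (u v : vseq D r) : tip u = tip v -> starB r (mB (u, v)) = mB
  (v, u).
Proof.
move=> e; rewrite (mBE v (erefl (tip u))) (mBE u (esym e)).
by rewrite !starB_mul starB_invol cB_star mulrA.
Qed.

(** Stands for the span of the path vectors in [U] inside the cell module of [lam] over [F], without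
    constructing that module. *)
Definition rspan r (lam : pt D r) (U : pred (vseq D r)) : B r -> Prop :=
  spn_mod (up lam) U (fun w => cB lam * dB w).

Lemma rspan_submod r (lam : pt D r) U : submod (rspan lam U).
Proof. exact: spn_mod_submod (up_submod lam) _ _. Qed.

Lemma rspan_up r (lam : pt D r) U x : up lam x -> rspan lam U x.
Proof. exact: spn_mod_sub. Qed.

Lemma rspan_gen r (lam : pt D r) (U : pred (vseq D r)) w : U w ->
  rspan lam U (cB lam * dB w).
Proof. exact: (spn_mod_gen (up_submod lam) (fun w => cB lam * dB w)). Qed.

Lemma rspan_min r (lam : pt D r) (U : pred (vseq D r)) (N : B r -> Prop) :
  submod N -> (forall x, up lam x -> N x) ->
  (forall w, U w -> N (cB lam * dB w)) -> forall x, rspan lam U x -> N x.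
Proof. exact: spn_mod_min. Qed.

Lemma rspan_mono r (lam : pt D r) (U U' : pred (vseq D r)) x :
  (forall w, U w -> U' w) -> rspan lam U x -> rspan lam U' x.
Proof.
move=> h; apply: rspan_min => [|y|w /h]; first exact: rspan_submod.
  exact: rspan_up.
exact: rspan_gen.
Qed.

Lemma rspan_mulr r (lam : pt D r) x : rspan lam (path_to lam) (cB lam * x).
Proof.
move: x; apply: iota_ind => [|a]; first exact: submod_mull (rspan_submod lam _).
have [k [hk _]] := cgen_core hD lam a.
exists (fun v => f (k v)); have := up_iota hk.
rewrite rmorphB rmorphM rmorph_sum.
by under eq_bigr do rewrite iotaZ rmorphM.
Qed.

(** Left multiplication by the starred path product of [v] turns the sum into one of Murphy elements
    at [lam], none of which is above [lam]. *)
Lemma up_free r (lam : pt D r) k :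
  up lam (\sum_(v | path_to lam v) k v *: (cB lam * dB v)) ->
  forall v, path_to lam v -> k v = 0.
Proof.
move=> h v hv.
have hU : up lam (\sum_(p | path_pair p)
    (if (p.1 == v) && path_to lam p.2 then k p.2 else 0) *: mB p).
  have -> : \sum_(p | path_pair p)
      (if (p.1 == v) && path_to lam p.2 then k p.2 else 0) *: mB p =
      starB r (dB v) * (\sum_(w | path_to lam w) k w *: (cB lam * dB w)).
    rewrite mulr_sumr [LHS](bigID (fun p => (p.1 == v) && path_to lam p.2)) /=.
    rewrite [X in _ + X]big1 ?addr0; last first.
      by move=> p /andP[_ /negPf ->]; rewrite scale0r.
    rewrite (reindex_onto (fun w => (v, w)) snd) /=; last first.
      by move=> [u w] /= /and3P[_ /eqP -> _].
    apply: eq_big => [w|w /andP[/andP[_ hw] _]].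
      rewrite !eqxx andbT /=; case hw: (path_to lam w);
        rewrite ?andbF ?andbT //.
      by have [] := path_pairP hv hw.
    by rewrite hw /= (mBE _ (eqP (andP hv).2)) -scalerAr mulrA.
  exact: up_mull.
have := lfree_disjoint (U' := pair_above lam) (@mB_free r) _ erefl hU.
move=> /(_ _ (v, v)) /=; rewrite eqxx hv /=; have [vp e] := path_pairP hv hv.
apply; [by move=> p /andP[] | exact: vp | by rewrite /pair_above e ltxx andbF].
Qed.

(** [cgen_core] yields some coefficients common to both levels, not the given [k]; [up_free]
    identifies the two, and so the support [U] is inherited by the next level. *)
Lemma rspan_core r (l : pt D r) (nu : pt D r.+1) (U : pred (vseq D r)) x :
  edge l nu -> (forall v, U v -> path_to l v) ->
  rspan l U (cB l * x) ->
  rspan nu (fun w => path_to nu w && ((l < tip w.1)%O || U w.1))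
    (cB nu * iota r.+1 (dbr l nu) * inclB r x).
Proof.
move=> enu Ul [k hk].
(* The two conditions are jointly linear in [x] and [k], so the [x] admitting some [k] form a
   submodule and [iota_ind] applies. *)
pose G (x : B r) (k : vseq D r -> F) :=
  up l (cB l * x - \sum_(v | path_to l v) k v *: (cB l * dB v)) /\
  rspan nu (fun w => path_to nu w && (l < tip w.1)%O)
    (cB nu * iota r.+1 (dbr l nu) * inclB r x -
     \sum_(v | path_to l v) k v *: (cB nu * dB (r := r.+1) (v, nu))).
have [k2 [h1 h2]] : exists k, G x k.
  move: (x); apply: iota_ind => [|a].
    split; first (exists (fun=> 0); split; rewrite ?linear0 ?mulr0 big1 ?subr0;
      try by [move=> v _; rewrite scale0r | exact: submod0 (up_submod _)
             | exact: submod0 (rspan_submod _ _)]).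
    move=> c y z [ky [h1 h2]] [kz [h3 h4]]; exists (fun v => c * ky v + kz v).
    have E (Y : vseq D r -> B r) (y' z' : B r) :
        c *: y' + z' - \sum_(v | path_to l v) (c * ky v + kz v) *: Y v =
        c *: (y' - \sum_(v | path_to l v) ky v *: Y v) +
          (z' - \sum_(v | path_to l v) kz v *: Y v).
      under eq_bigr do rewrite scalerDl -scalerA.
      by rewrite big_split /= -scaler_sumr scalerBr opprD addrACA.
    have E' (Y : vseq D r -> B r.+1) (y' z' : B r.+1) :
        c *: y' + z' - \sum_(v | path_to l v) (c * ky v + kz v) *: Y v =
        c *: (y' - \sum_(v | path_to l v) ky v *: Y v) +
          (z' - \sum_(v | path_to l v) kz v *: Y v).
      under eq_bigr do rewrite scalerDl -scalerA.
      by rewrite big_split /= -scaler_sumr scalerBr opprD addrACA.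
    split.
      by rewrite mulrDr -scalerAr E; apply: (up_submod l).2.
    by rewrite linearP mulrDr -scalerAr E'; apply: (rspan_submod nu _).2.
  have [ka [ha hb]] := cgen_core hD l a; exists (fun v => f (ka v)); split.
    have := up_iota ha; rewrite rmorphB rmorphM rmorph_sum.
    by under eq_bigr do rewrite iotaZ rmorphM.
  have [k' hk'] := hb nu enu; exists (fun w => f (k' w)); have := up_iota hk'.
  rewrite !rmorphB !rmorphM !rmorph_sum inclBE mulrA.
  under eq_bigr do rewrite iotaZ rmorphM.
  by under [X in _ - X]eq_bigr do rewrite iotaZ rmorphM.
have kE v : path_to l v -> k2 v = if U v then k v else 0.
  move=> hv; apply/eqP; rewrite -subr_eq0; apply/eqP; move: v hv.
  apply: up_free; rewrite (eq_bigr (fun v => k2 v *: (cB l * dB v) -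
    (if U v then k v else 0) *: (cB l * dB v))); last by move=> v _;
      rewrite scalerBl.
  have -> : \sum_(v | path_to l v)
      (k2 v *: (cB l * dB v) - (if U v then k v else 0) *: (cB l * dB v)) =
      (cB l * x - \sum_(v | U v) k v *: (cB l * dB v)) -
      (cB l * x - \sum_(v | path_to l v) k2 v *: (cB l * dB v)).
    rewrite opprB addrC addrA subrK sumrB; congr (_ - _).
    rewrite [LHS]big_mkcond [RHS]big_mkcond; apply: eq_bigr => v _ /=.
    by have := Ul v; case: (U v) => [->//|_]; case: ifP; rewrite ?scale0r.
  by apply: submodB => //; exact: up_submod.
rewrite -[X in rspan _ _ X](subrK (\sum_(v | path_to l v) k2 v *: (cB nu * dB
  (r := r.+1) (v, nu)))).
apply: submodD; first exact: rspan_submod.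
  by apply: rspan_mono h2 => w /andP[-> ->].
apply: submod_sum => [|v hv]; first exact: rspan_submod.
rewrite kE //; case Uv: (U v); last by rewrite scale0r;
  exact: submod0 (rspan_submod _ _).
apply: submodZ; first exact: rspan_submod.
apply: rspan_gen; rewrite /= Uv orbT andbT /path_to /= eqxx andbT.
by case/andP: hv => -> /eqP ->.
Qed.

(** The factors are replaced one at a time. Replacing [b] leaves terms with [a] on the left and a
    path above [t] on the right; there [a] is split again into its leading term and terms above
    [s]. *)
Lemma rspan_tri r (lam : pt D r) s t a b :
  path_to lam s -> path_to lam t ->
  rspan lam (fun w => path_to lam w && vabove s w) (cB lam * (a - dB s)) ->
  rspan lam (fun w => path_to lam w && vabove t w) (cB lam * (b - dB t)) ->
  spn (fun p => path_pair p && pabove (s, t) p) (@mB r)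
    (starB r a * cB lam * b - mB (s, t)).
Proof.
move=> hs ht ha hb; pose T := spn (fun p => path_pair p && pabove (s, t) p)
  (@mB r).
have hT : submod T by exact: spn_submod.
have ts : tip s = lam by case/andP: hs => _ /eqP.
have upT x : up lam x -> T x.
  apply: spn_mono => p /andP[-> /=]; rewrite /pabove /= ts; by move=> ->.
have genT u v : path_to lam u -> path_to lam v -> veqabove s u -> veqabove t v
  ->
    (s, t) != (u, v) -> T (mB (u, v)).
  move=> hu hv su tv ne; apply: spn_gen; have [-> tu] := path_pairP hu hv.
  by rewrite /pabove /= ts tu eqxx su tv ne orbT.
have starc x y : starB r x * cB lam * y = starB r (cB lam * x) * y.
  by rewrite starB_mul cB_star.
have mul_star u y : tip u = lam -> starB r (cB lam * dB u) * dB y = mB (u, y).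
  by move=> tu; rewrite (mBE _ tu) starc.
have tipl u : path_to lam u -> tip u = lam by case/andP=> _ /eqP.
rewrite (mBE _ ts) -(subrKA (starB r a * cB lam * dB t)) -mulrBr -!mulrBl
  -linearB.
apply: (submodD hT).
  rewrite -mulrA; apply: (rspan_min (submod_mull _ hT) _ _ hb) => [x
    /up_mull|v].
    by move=> h; exact: upT.
  case/andP=> hv tv; rewrite mulrA starc -[a](subrK (dB s)) mulrDr linearD
    mulrDl.
  apply: (submodD hT); last first.
    rewrite mul_star //; apply: genT => //;
      rewrite /veqabove ?eqxx ?tv ?orbT //.
    by rewrite xpair_eqE eqxx /=; apply: contraTneq tv => <-;
      rewrite vabove_irr.
  apply: (rspan_min (submod_lin (starB r) (submod_mulr _ hT)) _ _ ha) => [x|u].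
    by move=> /up_star/(up_mulr (dB v)); exact: upT.
  case/andP=> hu su; rewrite mul_star ?tipl //.
  apply: genT => //; rewrite /veqabove ?su ?tv ?orbT //.
  by rewrite xpair_eqE; apply: contraTN su => /andP[/eqP <- _];
    rewrite vabove_irr.
rewrite starc.
apply: (rspan_min (submod_lin (starB r) (submod_mulr _ hT)) _ _ ha) => [x|u].
  by move=> /up_star/(up_mulr (dB t)); exact: upT.
case/andP=> hu su; rewrite mul_star ?tipl //.
apply: genT => //; rewrite /veqabove ?su ?eqxx ?orbT //.
by rewrite xpair_eqE; apply: contraTN su => /andP[/eqP <- _];
  rewrite vabove_irr.
Qed.

End BaseChange.

(** * The kernel over the field of fractions *)

Section DimensionCount.
Variables (K L : fieldType) (tau : {rmorphism K -> L}).
Variables (W : lmodType K) (V : lmodType L) (iota : W -> V).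
Hypothesis bc : is_base_change tau iota.
Variables (I : finType) (P : pred I) (q : I -> W).

(** The coordinate matrix [G] of the vectors [iota (q p)] is square by the dimension hypothesis. If
    it is invertible, every relation is trivial. If it is singular, a null vector [w] defines a
    nonzero linear form on [V] vanishing on the image of [iota], against uniqueness in the universal
    property. *)
Lemma span_lfree : has_dim V #|P| -> (forall x, spn P q x) -> lfree P q.
Proof.
move=> [b /is_basisP[fb sb]] sq k hk.
have [g [gl gd]] := lfree_dual fb sb; have [il iu] := bc.
have gD i : {morph g i : x y / x + y}.
  by move=> x y; have := gl i isT 1 x y; rewrite scale1r mul1r.
have g0 i : g i 0 = 0 by apply: (addrI (g i 0)); rewrite -gD !addr0.
have gZ i c x : g i (c *: x) = c * g i x.
  by rewrite -[_ *: _]addr0 gl // g0 addr0.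
have i0 : iota 0 = 0.
  have := il 1 0 0; rewrite rmorph1 !scale1r !addr0 => h.
  by apply: (addrI (iota 0)); rewrite addr0 -h.
have iD : {morph iota : x y / x + y}.
  by move=> x y; have := il 1 x y; rewrite rmorph1 !scale1r.
have iS l : iota (\sum_(p | P p) l p *: q p) = \sum_(p | P p) tau (l p) *: iota
  (q p).
  rewrite (big_morph _ iD i0); apply: eq_bigr => p _.
  by rewrite -[_ *: q p]addr0 il i0 addr0.
pose G := \matrix_(j < #|P|, i < #|P|) g i (iota (q (enum_val j))).
have [uG|nG] := boolP (G \in unitmx).
  pose kr := \row_j tau (k (enum_val (A := P) j)).
  have kr0 : kr = 0.
    suff : kr *m G = 0 by move/(congr1 (mulmx^~ (invmx G)));
      rewrite mulmxK // mul0mx.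
    apply/rowP => i; rewrite !mxE.
    transitivity (g i (iota (\sum_(p | P p) k p *: q p)));
      last by rewrite hk i0 g0.
    rewrite iS (big_morph _ (gD i) (g0 i)) [RHS](eq_bigl (fun p => p \in P)) //.
    rewrite [RHS]big_enum_val.
    by apply: eq_bigr => j _; rewrite !mxE gZ.
  move=> p Pp; have := congr1 (fun M : 'rV_#|P| => M 0 (enum_rank_in Pp p)) kr0.
  by rewrite !mxE enum_rankK_in // => /eqP; rewrite fmorph_eq0 => /eqP.
have [w w0 hw] : exists2 w : 'rV_#|P|, w != 0 & w *m G^T = 0.
  have : kermx G^T != 0 by rewrite kermx_eq0 row_free_unit unitmx_tr.
  move=> /rowV0Pn[w /sub_kermxP hw w0]; by exists w.
pose h (x : V) : L^o := \sum_i w 0 i * g i x.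
have hl : linear h.
  move=> c x y; rewrite /h scaler_sumr -big_split; apply: eq_bigr => i _ /=.
  by rewrite gl // mulrDr; congr (_ + _); exact: mulrCA.
pose hL : {linear V -> L^o} := HB.pack h (GRing.isLinear.Build L V L^o *:%R h
  hl).
have s0 : semilinear_over tau ((fun=> 0) : W -> L^o).
  by move=> c x y; rewrite scaler0 addr0.
have [h0 [_ hu]] := iu _ _ s0.
have h_0 x : h x = 0.
  rewrite -[h x]/(hL x) hu.
    by rewrite -(hu \0).
  move=> y; have [l ->] := sq y; rewrite iS linear_sum big1 // => p Pp.
  rewrite linearZ /= /h;
    have := congr1 (fun M : 'rV_#|P| => M 0 (enum_rank_in Pp p)) hw.
  rewrite !mxE => e; rewrite (_ : \sum_i _ = 0) ?scaler0 // -[RHS]e.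
  by apply: eq_bigr => i _; rewrite !mxE enum_rankK_in.
case/negP: w0; apply/eqP/rowP => i;
  rewrite mxE -[RHS](h_0 (b i)) /h (bigD1 i) //=.
rewrite gd // eqxx mulr1 big1 ?addr0 // => j ji.
by rewrite gd // (negPf ji) mulr0.
Qed.

End DimensionCount.

(** * Modified path elements, integrality and the image in the quotient *)

Section QuotientTower.
Variables (R S : idomainType) (pi : {rmorphism R -> S}).
Variables (D : diagram_data R) (Q : quotient_data S D).
Hypotheses (hD : is_diagram_sequence D) (hQ : is_quotient_tower pi Q).

Definition iK r : {rmorphism alg D r -> gnA Q r} := toK Q r \o toS Q r.
Definition frac_pi : {rmorphism R -> {fraction S}} := @tofrac S \o pi.

Arguments iK : simpl never.

Lemma bcS r : is_base_change pi (toS Q r).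
Proof. exact: spA_base_change hQ r. Qed.

Lemma bcK r : is_base_change frac_pi (iK r).
Proof. exact: gnA_base_change hQ r. Qed.

Lemma inclK_iK r a : inclK Q r (iK r a) = iK r.+1 (incl D r a).
Proof. exact: inclKE hQ r a. Qed.

Lemma starK_iK r a : starK Q r (iK r a) = iK r (star a).
Proof. exact: starKE hQ r a. Qed.

Local Notation mS := (mB (toS Q)).
Local Notation mK := (mB iK).
Local Notation cK := (cB iK).
Local Notation dK := (dB iK).
Local Notation upK := (up iK).
Local Notation upS := (up (toS Q)).
Local Notation starKM := (starB_mul hD bcK starK_iK).
Local Notation starKI := (starB_invol hD bcK starK_iK).

Lemma toKZ r k (x : spA Q r) : toK Q r (k *: x) = tofrac k *: toK Q r x.
Proof.
by have := @toK_semilinear _ _ _ _ _ hQ r k x 0; rewrite !addr0 rmorph0 addr0.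
Qed.

Lemma toK_lin r k (x y : spA Q r) : toK Q r (k *: x + y) = tofrac k *: toK Q r
  x + toK Q r y.
Proof. by rewrite (@toK_semilinear _ _ _ _ _ hQ r). Qed.

Lemma toK_sum r (I : finType) (P : pred I) (k : I -> S) (b : I -> spA Q r) :
  toK Q r (\sum_(i | P i) k i *: b i) = \sum_(i | P i) tofrac (k i) *: toK Q r
    (b i).
Proof. by rewrite rmorph_sum; apply: eq_bigr => i _; rewrite toKZ. Qed.

Lemma submod_toK r (N : gnA Q r -> Prop) : submod N -> submod (fun x => N (toK
  Q r x)).
Proof.
move=> hN; split; first by rewrite rmorph0; exact: submod0.
by move=> k x y hx hy; rewrite toK_lin; exact: hN.2.
Qed.

(** An element of A_r^S has the same Murphy coefficients over [S] and over the fraction field, and a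
    coefficient that vanishes there vanishes in [S]. In this way triangularity proved with the
    non-integral [beta] descends. *)
Lemma toK_descend r (U : pred _) (y : spA Q r) : (forall p, U p -> path_pair p)
  ->
  spn U (mK (r := r)) (toK Q r y) -> spn U (mS (r := r)) y.
Proof.
move=> Up; have [k hk] := mB_span hD bcS y; rewrite {1}hk toK_sum => hU.
have k0 p : path_pair p -> ~~ U p -> tofrac (k p) = 0.
  move=> pp np; exact: (lfree_disjoint (mB_free hD bcK (r := r)) Up erefl hU pp
    np).
exists k; rewrite hk (bigID U) /= [X in _ + X]big1 ?addr0.
  by apply: eq_bigl => p; have := Up p; case: (U p) => [->//|]; rewrite andbF.
move=> p /andP[pp /(k0 _ pp)/eqP]; rewrite tofrac_eq0 => /eqP ->.
by rewrite scale0r.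
Qed.

Lemma toK_inj r : injective (toK Q r).
Proof.
move=> x y e; apply/eqP; rewrite -subr_eq0; apply/eqP.
have [] := @toK_descend r pred0 (x - y); rewrite // ?rmorphB ?e ?subrr.
  exact: submod0 (spn_submod _ _).
by move=> k; rewrite big_pred0.
Qed.

Lemma toK_incl r x : toK Q r.+1 (inclS Q r x) = inclK Q r (toK Q r x).
Proof.
move: x; apply: (iota_ind hD bcS) => [|a].
  split=> [|k x y hx hy]; first by rewrite !rmorph0.
  by rewrite linearP !toK_lin linearP hx hy.
by rewrite (inclSE hQ); exact/esym/inclK_iK.
Qed.

Lemma toK_star r x : toK Q r (starS Q r x) = starK Q r (toK Q r x).
Proof.
move: x; apply: (iota_ind hD bcS) => [|a].
  split=> [|k x y hx hy]; first by rewrite linear0 !rmorph0 linear0.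
  by rewrite linearP !toK_lin linearP hx hy.
by rewrite (starSE hQ); exact/esym/starK_iK.
Qed.

Lemma upS_toK r (lam : pt D r) x : upS lam x -> upK lam (toK Q r x).
Proof.
move: x; apply: spn_min => [|p hp]; first exact: submod_toK (up_submod _ _).
exact: (spn_gen (mK (r := r)) hp).
Qed.

(** Unlike [apath] alone, this product comes from A_r^S for every path, and [phi] kills it when the
    path is not permissible. *)
Definition zpath r (t : vseq D r) : gnA Q r := cK (tip t) * apath Q t.

Lemma apath_perm r (t : vseq D r) : perm_path (perm Q) t -> apath Q t = dK t.
Proof.
by case: r t => [|r] t /=; [rewrite /dB rmorph1 | case/andP=> -> ->].
Qed.

Lemma perm_path_tip r (t : vseq D r) : perm_path (perm Q) t -> perm Q (tip t).
Proof. by case: r t => [|r] //= t /andP[]. Qed.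

Lemma perm0 (t : vseq D 0) : perm_path (perm Q) t.
Proof. by rewrite /= (pt0_unique hD t) (perm_pt0 hQ). Qed.

Lemma marginal_last r (t : vseq D r.+1) : is_path t ->
  perm_path (perm Q) t.1 -> ~~ perm Q t.2 -> marginal (perm Q) t.2.
Proof.
move=> pt pt1 nt; split=> //.
have h : is_path t && (tip t == t.2) by rewrite pt /= eqxx.
by exists (Sub t h : StdPath t.2); rewrite SubK.
Qed.

Lemma zpath_marginal r (t : vseq D r.+1) : is_path t ->
  perm_path (perm Q) t.1 -> ~~ perm Q t.2 ->
  zpath t = toK Q r.+1 (bfrak Q t.2) * dK t.
Proof.
move=> pt pt1 nt; rewrite /zpath /= pt1 (negPf nt) mulrA.
by rewrite (betaP hQ (marginal_last pt pt1 nt)).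
Qed.

(** The up-branching factor moves the cell generator to the left past the last edge. Repeating this
    reduces questions about [zpath] to the first non-permissible vertex, where [zpath_marginal]
    exhibits [bfrak]. *)
Lemma zpath_step r (t : vseq D r.+1) : is_path t -> ~~ perm_path (perm Q) t.1 ->
  exists u, zpath t = starK Q r.+1 (iK r.+1 u) * inclK Q r (zpath t.1).
Proof.
case: t => t nu /= /andP[pt ed] np.
have [u hu] := ubr_exists hD ed; exists u.
rewrite /zpath /= (negPf np) mulrA starK_iK rmorphM mulrA; congr (_ * _).
transitivity (iK r.+1 (star u * incl D r (cgen (tip t)))).
  by rewrite -hu rmorphM.
by rewrite rmorphM; congr (_ * _); exact/esym/inclK_iK.
Qed.

Lemma zpath_lift r (t : vseq D r) : is_path t ->
  exists y, toK Q r y = zpath t.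
Proof.
elim: r t => [|r IH] t pt.
  by exists (toS Q 0 (cgen (tip t) * dpath t));
    rewrite /zpath apath_perm ?perm0 // 2!rmorphM.
have [p1|np1] := boolP (perm_path (perm Q) t.1); last first.
  have [u ->] := zpath_step pt np1.
  have [y hy] := IH t.1 (proj1 (andP pt)).
  exists (toS Q r.+1 (star u) * inclS Q r y).
  by rewrite rmorphM toK_incl hy starK_iK.
have [p2|np2] := boolP (perm Q t.2); last first.
  exists (bfrak Q t.2 * toS Q r.+1 (dpath t)).
  by rewrite zpath_marginal // rmorphM.
exists (toS Q r.+1 (cgen (tip t) * dpath t)).
by rewrite /zpath apath_perm ?/= ?p1 // 2!rmorphM.
Qed.

Lemma cgen_bfrak r (mu : pt D r) : marginal (perm Q) mu ->
  toK Q r (bfrak Q mu) = cK mu + toK Q r (bfrak' Q mu).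
Proof.
move=> hmu; have := congr1 (toK Q r) (cgen_split hQ hmu).
by rewrite rmorphB => h; rewrite -[cK mu]/(toK Q r (toS Q r (cgen mu))) h subrK.
Qed.

Lemma upK_bfrak' r (mu : pt D r) : marginal (perm Q) mu ->
  upK mu (toK Q r (bfrak' Q mu)).
Proof.
move=> hmu; apply: upS_toK; apply: (up_above hD bcS).
exact: (bfrak'_above hQ hmu).
Qed.

Lemma zpath_tri r (t : vseq D r) : is_path t ->
  rspan iK (tip t) (fun w => path_to (tip t) w && vabove t w)
    (cK (tip t) * (apath Q t - dK t)).
Proof.
elim: r t => [|r IH] t pt.
  by rewrite apath_perm ?perm0 // subrr mulr0;
    exact: submod0 (rspan_submod _ _ _).
have [p1|np1] := boolP (perm_path (perm Q) t.1).
  have [p2|np2] := boolP (perm Q t.2).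
    rewrite apath_perm /= ?p1 // subrr mulr0;
      exact: submod0 (rspan_submod _ _ _).
  (* At the first non-permissible vertex the difference is [bfrak'] times the path product, hence in
     the higher cells. *)
  rewrite mulrBr -/(zpath t) zpath_marginal // -mulrBl.
  have hmu := marginal_last pt p1 np2; rewrite cgen_bfrak // /= addrC addKr.
  by apply: rspan_up; apply: (up_mulr hD bcK); exact: upK_bfrak'.
(* Along a later edge [rspan_core] adds only paths with a higher penultimate vertex; this is the
   recursion in [vabove]. *)
case: t pt np1 => t nu /= /andP[pt ed] np; rewrite (negPf np).
have Ul v : path_to (tip t) v && vabove t v -> path_to (tip t) v by case/andP.
have := rspan_core hD bcK inclK_iK starK_iK ed Ul (IH t pt).
have -> : cK nu * iK r.+1 (dbr (tip t) nu) * inclK Q r (apath Q t - dK t) =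
    cK nu * (imK Q (dbr (tip t) nu) * inclK Q r (apath Q t) -
             dB iK (r := r.+1) (t, nu)).
  rewrite -mulrA rmorphB mulrBr /= /dB inclK_iK rmorphM mulrBr.
  by [].
apply: rspan_mono => w /andP[pw hw]; rewrite pw /=; apply/andP; split.
  by case/andP: pw => _; rewrite eq_sym.
by case/orP: hw => [->//|/andP[_ ->]]; rewrite orbT.
Qed.

Lemma phi_zpath r (t : vseq D r) : is_path t -> ~~ perm_path (perm Q) t ->
  phi Q r (zpath t) = 0.
Proof.
elim: r t => [|r IH] t pt; first by rewrite perm0.
have [p1|np1 _] := boolP (perm_path (perm Q) t.1); last first.
  have [u ->] := zpath_step pt np1.
  by rewrite rmorphM /= (phi_incl hQ) IH ?rmorph0 ?mulr0 //; case/andP: pt.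
rewrite /= p1 /= => np2; rewrite zpath_marginal // rmorphM /=.
have /= := bfrak_ker hQ (marginal_last pt p1 np2).
by rewrite /ker_phi => ->; rewrite mul0r.
Qed.

(* Only one of the two path factors is modified, which keeps these elements
   integral; [mtilde] need not be when neither path is permissible. *)
Definition nK r (p : vseq D r * vseq D r) : gnA Q r :=
  if perm_path (perm Q) p.2 then starK Q r (zpath p.1) * dK p.2
  else starK Q r (dK p.1) * zpath p.2.

Definition perm_pair r (p : vseq D r * vseq D r) : bool :=
  perm_path (perm Q) p.1 && perm_path (perm Q) p.2.

Lemma starK_zpath r (t : vseq D r) :
  starK Q r (zpath t) = starK Q r (apath Q t) * cK (tip t).
Proof. by rewrite starKM (cB_star hD starK_iK). Qed.

Lemma path_pair_to r (p : vseq D r * vseq D r) : path_pair p ->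
  path_to (tip p.1) p.1 /\ path_to (tip p.1) p.2.
Proof. by rewrite /path_to => /and3P[-> -> /eqP ->]; rewrite eqxx. Qed.

Lemma nK_tri r (p : vseq D r * vseq D r) : path_pair p ->
  spn (fun q => path_pair q && pabove p q) (mK (r := r)) (nK p - mK p).
Proof.
move=> hp; have [h1 h2] := path_pair_to hp; have /and3P[p1 p2 /eqP e] := hp.
have T0 (t : vseq D r) lam U : rspan iK lam U (cK lam * (dK t - dK t)).
  by rewrite subrr mulr0; exact: submod0 (rspan_submod _ _ _).
have T1 := zpath_tri p1; have T2 := zpath_tri p2.
case: p => s t in hp h1 h2 p1 p2 e T1 T2 *;
  rewrite /nK /= in h1 h2 p1 p2 e T1 T2 *.
case: ifP => _.
  by rewrite starK_zpath; apply: (rspan_tri hD bcK starK_iK h1 h2) => //;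
    exact: T0.
rewrite /zpath mulrA -e; apply: (rspan_tri hD bcK starK_iK h1 h2);
  first exact: T0.
by rewrite e.
Qed.

Lemma mtilde_tri r (s t : vseq D r) : path_pair (s, t) ->
  spn (fun q => path_pair q && pabove (s, t) q) (mK (r := r))
    (mtilde Q (tip s) s t - mK (s, t)).
Proof.
move=> hp; have [h1 h2] := path_pair_to hp; have /and3P[/= p1 p2 /eqP e] := hp.
have T1 := zpath_tri p1; have T2 := zpath_tri p2.
by apply: (rspan_tri hD bcK starK_iK h1 h2) => //=; rewrite e.
Qed.

Lemma nK_perm r (p : vseq D r * vseq D r) : perm_pair p -> nK p = mK p.
Proof.
case: p => s t /andP[/= ps ptt]; rewrite /nK /= ptt starK_zpath apath_perm //.
by rewrite (mBE starK_iK _ (erefl (tip s))).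
Qed.

Lemma nK_spn r (U : pred (vseq D r * vseq D r)) :
  (forall p, U p -> path_pair p) ->
  (forall p q, U p -> path_pair q -> pabove p q -> U q) ->
  forall x, spn U (nK (r := r)) x <-> spn U (mK (r := r)) x.
Proof. exact: (unitri_spn (@pabove_irr _ D r) (@pabove_trans _ D r) (@nK_tri
  r)). Qed.

Lemma nK_free r : lfree (@path_pair _ D r) (nK (r := r)).
Proof.
exact: (unitri_lfree (@pabove_irr _ D r) (@pabove_trans _ D r) (@nK_tri r)
  (mB_free hD bcK (r := r))).
Qed.

Lemma nK_span r x : spn (@path_pair _ D r) (nK (r := r)) x.
Proof. by apply/nK_spn => //; exact: (mB_span hD bcK). Qed.

Lemma pair_above_up r (lam : pt D r) p q :
  pair_above lam p -> path_pair q -> pabove p q -> pair_above lam q.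
Proof.
rewrite /pair_above => /andP[_ lp] -> /=.
by case/orP=> [/(lt_trans lp)|/andP[/eqP <-]].
Qed.

Lemma card_perm_pair r :
  #|[pred p | @path_pair _ D r p && perm_pair p]| =
  (\sum_(nu : pt D r | perm Q nu) #|StdPerm (perm Q) nu| ^ 2)%N.
Proof.
rewrite -sum1_card (partition_big (fun p => tip p.1) (perm Q (r := r))) /=.
  apply: eq_bigr => nu _; rewrite card_sig -mulnn -cardX -sum1_card.
  apply: eq_bigl => -[u v]; rewrite !inE /path_pair /perm_pair /=.
  have [->|_] := eqVneq (tip u) nu; last by rewrite !andbF.
  rewrite andbT eq_sym; case: (is_path u); case: (is_path v);
    rewrite ?andbF //=.
  by case: (tip v == nu); rewrite ?andbF.
by move=> p /andP[_ /andP[/perm_path_tip]].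
Qed.

Definition star_inv r := forall x, phi Q r x = 0 -> phi Q r (starK Q r x) = 0.

Lemma phi_star_submod r : submod (fun z => phi Q r (starK Q r z) = 0).
Proof.
split=> [|k x y hx hy]; first by rewrite !linear0.
by rewrite linearP /= linearP /= hx hy scaler0 addr0.
Qed.

(** * Invariance of the kernel under the involution, from one level to the next *)

Section StarInvariance.
Variable r : nat.
Hypothesis IH : if r is r'.+1 then star_inv r' else True.

(** With a permissible endpoint, the path has failed before its last vertex; so [zpath_step]
    applies, and the starred factor from the previous level is killed by [IH]. *)
Lemma phi_star_step (t : vseq D r) : is_path t -> ~~ perm_path (perm Q) t ->
  perm Q (tip t) -> phi Q r (starK Q r (zpath t)) = 0.
Proof.
case: r t IH => [|r'] t; first by rewrite perm0.
move=> hi pt np pn; have np1 : ~~ perm_path (perm Q) t.1.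
  by apply: contraNN np => /= ->.
have [u ->] := zpath_step pt np1.
rewrite starKM (starB_incl hD bcK inclK_iK starK_iK) rmorphM /= (phi_incl hQ).
rewrite hi ?rmorph0 ?mul0r //; apply: phi_zpath => //.
by case/andP: pt.
Qed.

(** If the second path is permissible, so is the common endpoint, and [phi_star_step] treats the
    first path. Otherwise the second path is the modified one and its element appears unstarred;
    this dictates the choice made in [nK]. *)
Lemma phi_nK p : path_pair p -> ~~ perm_pair p -> phi Q r (nK p) = 0.
Proof.
case: p => s t hp np; have /and3P[/= ps ptt /eqP e] := hp.
rewrite /nK /=; case: ifP => pt2;
  last by rewrite rmorphM /= phi_zpath ?mulr0 ?pt2.
rewrite rmorphM /= phi_star_step ?mul0r //; last by rewrite e;
  exact: perm_path_tip.
by move: np; rewrite /perm_pair /= pt2 andbT.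
Qed.

Lemma phi_perm_span x :
  spn (fun p => path_pair p && perm_pair p) (phi Q r \o mK (r := r)) x.
Proof.
have [y <-] := phi_surj hQ x; have [k ->] := nK_span y.
exists k; rewrite linear_sum (bigID (@perm_pair r)) /= [X in _ + X]big1 ?addr0.
  by apply: eq_bigr => p /andP[_ pp]; rewrite linearZ nK_perm.
by move=> p /andP[pp np]; rewrite linearZ /= phi_nK // scaler0.
Qed.

Lemma phi_perm_free : lfree (fun p => path_pair p && perm_pair p) (phi Q r \o
  mK (r := r)).
Proof.
have [V [io [hb hd]]] := dim_Q hQ r.
apply: (span_lfree hb); last exact: phi_perm_span.
by rewrite -card_perm_pair in hd.
Qed.

Lemma ker_nK x : phi Q r x = 0 ->
  spn (fun p => path_pair p && ~~ perm_pair p) (nK (r := r)) x.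
Proof.
have [k ->] := nK_span x => hx; exists k.
rewrite (bigID (@perm_pair r)) /= big1 ?add0r // => p hp.
rewrite (phi_perm_free (k := k)) ?scale0r //.
rewrite -[RHS]hx linear_sum [RHS](bigID (@perm_pair r)) /= [X in _ = _ + X]big1
  ?addr0.
  by apply: eq_bigr => q /andP[_ pp]; rewrite linearZ nK_perm.
by move=> q /andP[pp np]; rewrite linearZ /= phi_nK // scaler0.
Qed.

(* With b' = m x and w = x^* m x, the element b'^* + w of the kernel lies in
   the span of the higher cells; applying phi to its image under * gives
   phi(b') = - phi(w) = phi(b'^* ). *)
Lemma phi_star_marginal (mu : pt D r) : marginal (perm Q) mu ->
  (forall z, upK mu z -> phi Q r z = 0 -> phi Q r (starK Q r z) = 0) ->
  phi Q r (starK Q r (toK Q r (bfrak Q mu))) = 0.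
Proof.
move=> hmu hz; have hb := bfrak_ker hQ hmu;
  rewrite /ker_phi cgen_bfrak // in hb.
have [x hx] := bfrak'_cgen hQ hmu; rewrite -[imK Q _]/(cK mu) in hx.
have hup := upK_bfrak' hmu; rewrite cgen_bfrak //.
set b := toK Q r (bfrak' Q mu) in hb hx hup *.
have sc : starK Q r (cK mu) = cK mu := cB_star hD starK_iK mu.
pose w := starK Q r x * b.
have sb : starK Q r b = starK Q r x * cK mu by rewrite hx starKM sc.
have sw : starK Q r w = w by rewrite /w starKM starKI sb hx mulrA.
have e : phi Q r (starK Q r b) = - phi Q r w.
  apply/eqP; rewrite -addr_eq0 sb /w -rmorphD -mulrDr rmorphM /=.
  by rewrite hb mulr0.
have hs : starK Q r (starK Q r b + w) = b + w by rewrite linearD /= starKI sw.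
have h : phi Q r (b + w) = 0.
  rewrite -hs; apply: hz; last by rewrite rmorphD /= e addNr.
  by apply: submodD; [exact: up_submod | exact: (up_star hD bcK starK_iK)
    | exact: (up_mull hD bcK)].
rewrite linearD /= sc rmorphD /= e -hb; apply/eqP;
  rewrite rmorphD /= (inj_eq (addrI _)).
by rewrite eq_sym -addr_eq0 -h rmorphD.
Qed.

(** Starring [nK] may produce a starred [zpath] whose endpoint is not permissible. Induction from
    the highest points down supplies what [phi_star_marginal] requires of the higher cells. *)
Lemma phi_star_nK p : path_pair p -> ~~ perm_pair p ->
  phi Q r (starK Q r (nK p)) = 0.
Proof.
move: {2}(tip p.1) (erefl (tip p.1)) => lam; move: p.
elim: {lam}_.+1 {-2}lam (ltnSn #|[pred mu | (lam < mu)%O]|) => // n IHn lam hn.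
(* Such a [z] is supported on non-permissible pairs, being in the kernel, and on pairs above [lam];
   by freeness of [nK] it is supported on pairs satisfying both, to which the induction applies. *)
have hup z : upK lam z -> phi Q r z = 0 -> phi Q r (starK Q r z) = 0.
  move=> hz /ker_nK hk.
  have {}hz : spn (pair_above lam) (nK (r := r)) z.
    apply/nK_spn => //; first by move=> q /andP[].
    exact: pair_above_up.
  have {hk hz} : spn (fun p => pair_above lam p && ~~ perm_pair p) (nK (r :=
    r)) z.
    have [k hk'] := hk; exists k; rewrite hk' (bigID (pair_above lam)) /=.
    rewrite [X in _ + X]big1 ?addr0.
      apply: eq_bigl => q; rewrite /pair_above.
      by case: (path_pair q); rewrite ?andbF //= andbC.
    move=> q /andP[/andP[pq nq] na].
    have sub p : pair_above lam p -> path_pair p by case/andP.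
    have hE : z = \sum_(p | path_pair p) (if ~~ perm_pair p then k p else 0) *:
      nK p.
      rewrite hk' big_mkcondr /=; apply: eq_bigr => p _.
      by case: ifP; rewrite ?scale0r.
    have := lfree_disjoint (@nK_free r) sub hE hz pq na.
    by rewrite nq => ->; rewrite scale0r.
  apply: (spn_min (N := fun z => phi Q r (starK Q r z) = 0)) =>
    [|q /andP[/andP[pq lq] nq]]; first exact: phi_star_submod.
  apply: (IHn (tip q.1)) => //; rewrite -ltnS; apply: leq_trans hn;
    rewrite ltnS.
  apply: proper_card; apply/properP; split.
    by apply/subsetP => x; rewrite !inE; exact: lt_trans.
  by exists (tip q.1); rewrite !inE ?ltxx.
(* A permissible endpoint or an earlier non-permissible vertex reduces to the previous level. Only
   when the last vertex is the first to fail is [phi_star_marginal] needed. *)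
have hzp (t : vseq D r) : is_path t -> ~~ perm_path (perm Q) t -> tip t = lam ->
    phi Q r (starK Q r (zpath t)) = 0.
  move=> pt np tl; have [pn|nn] := boolP (perm Q (tip t)).
    exact: phi_star_step.
  case: r t IH lam hup pt np tl nn {IHn hn}
    (@phi_star_marginal lam) => [|r'] t hi lam hup pt np tl nn hM.
    by rewrite perm0 in np.
  have [p1|np1] := boolP (perm_path (perm Q) t.1).
    have {}tl : t.2 = lam := tl; rewrite -tl in hM hup.
    rewrite zpath_marginal // starKM rmorphM /= hM ?mulr0 //.
    exact: marginal_last.
  have [u ->] := zpath_step pt np1.
  rewrite starKM (starB_incl hD bcK inclK_iK starK_iK) rmorphM /= (phi_incl hQ).
  rewrite hi ?rmorph0 ?mul0r //; apply: phi_zpath => //.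
  by case/andP: pt.
move=> [s t] tl hp np; have /and3P[/= ps ptt /eqP e] := hp.
rewrite /nK /=; case: ifP => pt2.
  rewrite starKM starKI rmorphM /= phi_zpath ?mulr0 //.
  by move: np; rewrite /perm_pair /= pt2 andbT.
rewrite starKM starKI rmorphM /= hzp ?mul0r ?pt2 //.
by rewrite -e.
Qed.

Lemma star_inv_step : star_inv r.
Proof.
move=> x /ker_nK; apply: (spn_min (N := fun z => phi Q r (starK Q r z) = 0)) =>
  [|p /andP[pp np]]; last exact: phi_star_nK.
exact: phi_star_submod.
Qed.

End StarInvariance.

Lemma star_inv_all r : star_inv r.
Proof. by elim: r => [|r IH]; exact: star_inv_step. Qed.

End QuotientTower.

(** * The kernel over S *)

Section IntegralKernel.
Variables (R S : idomainType) (pi : {rmorphism R -> S}).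
Variables (D : diagram_data R) (Q : quotient_data S D).
Hypotheses (hD : is_diagram_sequence D) (hQ : is_quotient_tower pi Q).

Local Notation mS := (mB (toS Q)).
Local Notation mK := (mB (iK Q)).
Local Notation dK := (dB (iK Q)).
Local Notation dS := (dB (toS Q)).
Local Notation hbcS := (bcS hQ).
Local Notation hstarK := (starK_iK hQ).
Local Notation hstarS := (starSE hQ).

Lemma star_inv_prev r : if r is r'.+1 then star_inv Q r' else True.
Proof. by case: r => [//|r]; exact: (star_inv_all hD hQ). Qed.

Lemma ker_phi_star r (x : spA Q r) : ker_phi x -> ker_phi (starS Q r x).
Proof. by rewrite /ker_phi (toK_star hD hQ); exact: (star_inv_all hD hQ). Qed.

Lemma phiS_eq0 r (x : spA Q r) : phiS Q r x = 0 <-> ker_phi x.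
Proof.
rewrite /ker_phi -(QS_valE hQ); split=> [->|h]; first exact: rmorph0.
by apply: (QS_val_inj hQ); rewrite h rmorph0.
Qed.

Lemma ker_phi_submod r : submod (@ker_phi R S D Q r).
Proof.
split=> [|k x y /phiS_eq0 hx /phiS_eq0 hy]; apply/phiS_eq0;
  first exact: linear0.
by rewrite linearP /= hx hy scaler0 addr0.
Qed.

Lemma ker_phi_ideal r : two_sided_ideal (@ker_phi R S D Q r).
Proof.
split; first exact: submod0 (ker_phi_submod r).
  exact: submodD (ker_phi_submod r).
by move=> a x b /phiS_eq0 hx; apply/phiS_eq0;
  rewrite !rmorphM /= hx mulr0 mul0r.
Qed.

Definition perm_pairs r : pred (vseq D r * vseq D r) :=
  fun p => path_pair p && perm_pair Q p.

Definition nonperm_pairs r : pred (vseq D r * vseq D r) :=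
  fun p => path_pair p && ~~ perm_pair Q p.

(** * A kernel basis from an integral triangular family, applied to both [nK] and [mtilde] *)

Section IntegralBasis.
Variables (r : nat) (e : vseq D r * vseq D r -> gnA Q r).
Variables (eS : vseq D r * vseq D r -> spA Q r).
Hypothesis eSE : forall p, path_pair p -> toK Q r (eS p) = e p.
Hypothesis e_tri : forall p, path_pair p ->
  spn (fun q => path_pair q && pabove p q) (mK (r := r)) (e p - mK p).
Hypothesis e_perm : forall p, perm_pairs p -> e p = mK p.
Hypothesis e_ker : forall p, nonperm_pairs p -> phi Q r (e p) = 0.

Lemma int_tri p : path_pair p ->
  spn (fun q => path_pair q && pabove p q) (mS (r := r)) (eS p - mS p).
Proof.
move=> hp; apply: (toK_descend hD hQ); first by move=> q /andP[].
by rewrite rmorphB /= eSE //; exact: e_tri.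
Qed.

Lemma int_spn (U : pred (vseq D r * vseq D r)) :
  (forall p, U p -> path_pair p) ->
  (forall p q, U p -> path_pair q -> pabove p q -> U q) ->
  forall x, spn U eS x <-> spn U (mS (r := r)) x.
Proof. exact: (unitri_spn (@pabove_irr _ D r) (@pabove_trans _ D r) int_tri).
  Qed.

Lemma int_free : lfree (@path_pair _ D r) eS.
Proof.
exact: (unitri_lfree (@pabove_irr _ D r) (@pabove_trans _ D r) int_tri
  (mB_free hD hbcS (r := r))).
Qed.

Lemma int_span x : spn (@path_pair _ D r) eS x.
Proof. by apply/int_spn => //; exact: (mB_span hD hbcS). Qed.

Lemma int_perm p : perm_pairs p -> eS p = mS p.
Proof.
move=> hp; apply: (toK_inj hD hQ); rewrite eSE ?e_perm //.
by case/andP: hp.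
Qed.

Lemma int_ker p : nonperm_pairs p -> ker_phi (eS p).
Proof. by move=> hp; rewrite /ker_phi eSE ?e_ker //; case/andP: hp. Qed.

Lemma ker_phi_spn x : ker_phi x -> spn (@nonperm_pairs r) eS x.
Proof.
have [k ->] := int_span x => hx; exists k.
rewrite (bigID (@perm_pair _ _ _ Q r)) /= big1 ?add0r // => p hp.
have hk : \sum_(p | perm_pairs p) tofrac (k p) *: (phi Q r \o mK (r := r)) p =
  0.
  rewrite -[RHS]hx (toK_sum hQ) linear_sum [RHS](bigID (@perm_pair _ _ _ Q r))
    /=.
  rewrite [X in _ = _ + X]big1 ?addr0 => [|q hq].
    by apply: eq_bigr => q hq; rewrite linearZ /= eSE ?e_perm //; case/andP: hq.
  by rewrite linearZ /= eSE ?e_ker ?scaler0 //; case/andP: hq.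
have := phi_perm_free hD hQ (star_inv_prev r) hk hp.
by move=> /eqP; rewrite tofrac_eq0 => /eqP ->; rewrite scale0r.
Qed.

End IntegralBasis.

Lemma nK_ker r p : nonperm_pairs (r := r) p -> phi Q r (nK Q p) = 0.
Proof. by case/andP; exact: (phi_nK hD hQ (star_inv_prev r)). Qed.

Lemma nK_perm_pairs r p : perm_pairs (r := r) p -> nK Q p = mK p.
Proof. by case/andP => _; exact: (nK_perm hD hQ). Qed.

Lemma nS_exists r : exists nS : vseq D r * vseq D r -> spA Q r,
  forall p, path_pair p -> toK Q r (nS p) = nK Q p.
Proof.
apply: (fin_all_exists (P := fun p y => path_pair p -> toK Q r y = nK Q p)) =>
  -[s t].
case hp: (path_pair (s, t)); last by exists 0.
have /and3P[ps ptt _] := hp.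
have [g1 h1] := zpath_lift hD hQ ps; have [g2 h2] := zpath_lift hD hQ ptt.
rewrite /nK /=; case: ifP => _.
  by exists (starS Q r g1 * dS t) => _; rewrite rmorphM /= (toK_star hD hQ) h1.
exists (starS Q r (dS s) * g2) => _.
by rewrite rmorphM /= (toK_star hD hQ) h2.
Qed.

(** * Generation of the kernel by the marginal elements *)

Local Notation genideal r := (ideal_generated (@marginal_gen R S D Q r)).

Lemma ideal_generated_ideal (A : pzRingType) (X : A -> Prop) :
  two_sided_ideal (ideal_generated X).
Proof.
split=> [I [] //|x y hx hy I hI hX|a x b hx I hI hX]; have [_ hD' hM] := hI.
  by apply: hD'; [exact: hx | exact: hy].
by apply: hM; exact: hx.
Qed.

Lemma genideal_mull r a x : genideal r x -> genideal r (a * x).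
Proof.
by move=> hx; rewrite -[a * x]mulr1;
  have [_ _ h] := ideal_generated_ideal (@marginal_gen R S D Q r); exact: h.
Qed.

Lemma genideal_mulr r a x : genideal r x -> genideal r (x * a).
Proof.
by move=> hx; rewrite -[x]mul1r;
  have [_ _ h] := ideal_generated_ideal (@marginal_gen R S D Q r); exact: h.
Qed.

Lemma genideal_submod r : submod (genideal r).
Proof.
have [h0 hD' _] := ideal_generated_ideal (@marginal_gen R S D Q r).
split=> // k x y hx hy; apply: hD' => //; rewrite -mulr_algl;
  exact: genideal_mull.
Qed.

Lemma genideal_incl r x : genideal r x -> genideal r.+1 (inclS Q r x).
Proof.
move=> h; apply: (h (fun x => genideal r.+1 (inclS Q r x))).
  split; first by rewrite rmorph0; exact: submod0 (genideal_submod _).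
    by move=> y z hy hz; rewrite rmorphD;
      exact: submodD (genideal_submod _) _ _ hy hz.
  by move=> a y b hy; rewrite !rmorphM; apply: genideal_mulr;
    exact: genideal_mull.
by move=> y hy I _; apply; exact: marginal_up.
Qed.

Lemma zpath_genideal r (t : vseq D r) g : is_path t ->
  ~~ perm_path (perm Q) t -> toK Q r g = zpath Q t -> genideal r g.
Proof.
elim: r t g => [|r IH] t g pt; first by rewrite (perm0 hD hQ).
have [p1|np1 _] := boolP (perm_path (perm Q) t.1); last first.
  have [u ->] := zpath_step hD hQ pt np1.
  have p1 : is_path t.1 by case/andP: pt.
  have [g' hg'] := zpath_lift hD hQ p1.
  rewrite -hg' -(toK_incl hD hQ) -(toK_star hD hQ (toS Q r.+1 u)) -rmorphM.
  move=> /(toK_inj hD hQ) ->; apply: genideal_mull; apply: genideal_incl.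
  exact: IH hg'.
rewrite /= p1 /= => np2; rewrite (zpath_marginal hQ) //.
rewrite -[dK t]/(toK Q r.+1 (dS t)) -rmorphM => /(toK_inj hD hQ) ->.
apply: genideal_mulr => I _; apply; apply: marginal_here => //.
exact: marginal_last p1 np2.
Qed.

(** The generated ideal is not visibly stable under the involution, so a starred [zpath s] is not
    treated directly. By [zpath_step] it is a right multiple of the starred element of [s.1]; that
    lies in the previous kernel by [ker_phi_star], hence in the previous ideal by induction. *)
Lemma ker_phi_genideal r x : ker_phi x -> genideal r x.
Proof.
elim: r x => [|r IH] x.
  have [nS nSE] := nS_exists 0.
  move=> /(ker_phi_spn nSE (@nK_tri _ _ _ _ _ hD hQ 0) (@nK_perm_pairs 0)
    (@nK_ker 0)).
  apply: spn_min => [|p /andP[_]]; first exact: genideal_submod.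
  by rewrite /perm_pair !(perm0 hD hQ).
have [nS nSE] := nS_exists r.+1.
move=> /(ker_phi_spn nSE (@nK_tri _ _ _ _ _ hD hQ _) (@nK_perm_pairs _)
  (@nK_ker _)).
apply: spn_min => [|[s t] /andP[hp np]]; first exact: genideal_submod.
have /and3P[/= ps ptt /eqP e] := hp; have := nSE _ hp; rewrite /nK /=.
case: ifP => pt2; last first.
  have [g hg] := zpath_lift hD hQ (r := r.+1) (t := t) ptt.
  rewrite -hg -[dB _ _]/(toK Q r.+1 (dS (r := r.+1) s)) -(toK_star hD hQ)
    -rmorphM.
  move=> /(toK_inj hD hQ) ->; apply: genideal_mull.
  by apply: zpath_genideal hg => //=; rewrite pt2.
have /andP[pt1 ptl] := pt2.
have ns1 : ~~ perm_path (perm Q) s.1.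
  by move: np; rewrite /perm_pair /= e pt1 ptl !andbT.
have [u hu] := zpath_step hD hQ (r := r) (t := s) ps ns1.
have p1 : is_path s.1 by case/andP: ps.
have [g hg] := zpath_lift hD hQ p1.
rewrite hu -hg -(toK_incl hD hQ) -[iK _ _ _]/(toK Q r.+1 (toS Q r.+1 u)).
rewrite -(toK_star hD hQ) -rmorphM -(toK_star hD hQ).
rewrite -[dB _ _]/(toK Q r.+1 (dS (r := r.+1) t)) -rmorphM => /(toK_inj hD hQ)
  ->.
apply: genideal_mulr; rewrite (starB_mul hD hbcS hstarS); apply: genideal_mulr.
rewrite (starB_incl hD hbcS (inclSE hQ) hstarS); apply: genideal_incl.
apply: IH; apply: ker_phi_star; rewrite /ker_phi hg.
exact: (phi_zpath hD hQ).
Qed.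

Lemma marginal_gen_ker r (x : spA Q r) : marginal_gen x -> ker_phi x.
Proof.
elim=> {r x} [r mu _|r x _]; first exact: (bfrak_ker hQ).
rewrite /ker_phi (toK_incl hD hQ) (phi_incl hQ) => ->; exact: rmorph0.
Qed.

Lemma ker_phiE r (x : spA Q r) : ker_phi x <-> genideal r x.
Proof.
split=> [|h]; first exact: ker_phi_genideal.
by apply: h; [exact: ker_phi_ideal | exact: marginal_gen_ker].
Qed.

(** The cell generator can be absorbed by either path, so each [mtilde] contains [zpath] of its
    non-permissible path, starred or not, and is killed. A permissible path has an integral [apath],
    so integrality is assumed only for pairs with both paths non-permissible. *)
Lemma kappa_basis r :
  (forall (lam : pt D r) (s t : StdPath lam),
     ~~ perm_path (perm Q) (val s) -> ~~ perm_path (perm Q) (val t) ->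
     exists x : spA Q r, toK Q r x = mtilde Q lam (val s) (val t)) ->
  exists kap : kappa_index Q r -> spA Q r,
    (forall i, toK Q r (kap i) = kappa i) /\
    is_basis_of (@ker_phi R S D Q r) kap.
Proof.
move=> hnn; pose e (p : vseq D r * vseq D r) := mtilde Q (tip p.1) p.1 p.2.
have mtilde_zl s t : tip s = tip t -> e (s, t) = starK Q r (zpath Q s) * apath
  Q t.
  by move=> _; rewrite (starK_zpath hD hQ).
have mtilde_zr s t : tip s = tip t -> e (s, t) = starK Q r (apath Q s) * zpath
  Q t.
  by move=> h; rewrite /e /mtilde /zpath -h mulrA.
have [eS eSE] : exists eS : vseq D r * vseq D r -> spA Q r,
    forall p, path_pair p -> toK Q r (eS p) = e p.
  apply: (fin_all_exists (P := fun p y => path_pair p -> toK Q r y = e p)) =>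
    -[s t].
  case hp: (path_pair (s, t)); last by exists 0.
  have /and3P[/= ps ptt /eqP est] := hp.
  have [g1 h1] := zpath_lift hD hQ ps; have [g2 h2] := zpath_lift hD hQ ptt.
  have [pt2|nt2] := boolP (perm_path (perm Q) t).
    exists (starS Q r g1 * dS t) => _; rewrite rmorphM /= (toK_star hD hQ) h1.
    by rewrite mtilde_zl // (apath_perm pt2).
  have [ps2|ns2] := boolP (perm_path (perm Q) s).
    exists (starS Q r (dS s) * g2) => _; rewrite rmorphM /= (toK_star hD hQ) h2.
    by rewrite mtilde_zr // (apath_perm ps2).
  have hs : is_path s && (tip s == tip s) by rewrite ps eqxx.
  have ht : is_path t && (tip t == tip s) by rewrite ptt est eqxx.
  have [x hx] := hnn (tip s) (Sub s hs) (Sub t ht) ns2 nt2.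
  by exists x.
have e_tri p : path_pair p ->
    spn (fun q => path_pair q && pabove p q) (mK (r := r)) (e p - mK p).
  by case: p => s t hp; exact: (mtilde_tri hD hQ).
have e_perm p : perm_pairs p -> e p = mK p.
  case: p => s t /andP[/and3P[_ _ /eqP est] /andP[ps ptt]].
  rewrite (mBE hstarK _ (erefl (tip s))) /e /mtilde /=.
  by rewrite (apath_perm ps) (apath_perm ptt).
have e_ker p : nonperm_pairs p -> phi Q r (e p) = 0.
  case: p => s t /andP[/and3P[/= ps ptt /eqP est]];
    rewrite /perm_pair /= negb_and.
  case/orP=> [ns|nt].
    rewrite mtilde_zl // rmorphM /= (star_inv_all hD hQ) ?mul0r //.
    exact: (phi_zpath hD hQ).
  by rewrite mtilde_zr // rmorphM /= (phi_zpath hD hQ) ?mulr0.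
pose h (i : kappa_index Q r) : vseq D r * vseq D r :=
  (val (tagged (val i)).1, val (tagged (val i)).2).
have tips (lam : pt D r) (s : StdPath lam) : is_path (val s) /\ tip (val s) =
  lam.
  by case: s => s /= /andP[-> /eqP].
have hinj : injective h.
  move=> [[l1 [s1 t1]] h1] [[l2 [s2 t2]] h2] [/= es et]; apply: val_inj => /=.
  have el : l1 = l2 by rewrite -(tips _ s1).2 -(tips _ s2).2; congr tip;
    exact: es.
  by case: l2 / el in s2 t2 h2 es et *; rewrite (val_inj es) (val_inj et).
have hP i : nonperm_pairs (h i).
  case: i => [[lam [s t]] /= hi];
    rewrite /nonperm_pairs /path_pair /perm_pair /=.
  rewrite (tips _ s).1 (tips _ s).2 (tips _ t).1 (tips _ t).2 eqxx negb_and.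
  exact: hi.
have hsurj p : nonperm_pairs p -> exists i, h i = p.
  case: p => s t /andP[/and3P[/= ps ptt /eqP est]];
    rewrite /perm_pair /= negb_and => hi.
  have hs : is_path s && (tip s == tip s) by rewrite ps eqxx.
  have ht : is_path t && (tip t == tip s) by rewrite ptt est eqxx.
  pose i0 : {lam : pt D r & (StdPath lam * StdPath lam)%type} :=
    Tagged (fun lam : pt D r => (StdPath lam * StdPath lam)%type)
      (Sub s hs : StdPath (tip s), Sub t ht : StdPath (tip s)).
  by exists (Sub i0 hi).
exists (eS \o h); split=> [i|].
  rewrite /= eSE; last by case/andP: (hP i).
  case: i => [[lam [s t]] hi]; rewrite /e /kappa /h /=.
  by rewrite (tips _ s).2.
split=> [i|x hx]; first exact: (int_ker eSE e_ker).
have := ker_phi_spn eSE e_tri e_perm e_ker hx.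
move=> /(spn_reindex hinj hP hsurj)[k hk].
have fr : lfree predT (eS \o h).
  apply: (lfree_reindex hinj hP hsurj) => k' hk' p hp.
  have := int_free eSE e_tri (k := fun q => if ~~ perm_pair Q q then k' q else
    0).
  move=> /(_ _ p); case/andP: hp => hp1 hp2; rewrite hp2; apply=> //.
  rewrite -[RHS]hk' [RHS]big_mkcondr /=; apply: eq_bigr => q _.
  by case: ifP; rewrite ?scale0r.
exists [ffun i => k i]; split=> [|l hl].
  by rewrite hk; apply: eq_bigr => i _; rewrite ffunE.
apply/ffunP => i; rewrite ffunE; apply/eqP; rewrite -subr_eq0; apply/eqP.
apply: (fr (fun i => k i - l i)) => //.
under eq_bigr do rewrite scalerBl.
by rewrite sumrB -hk hl subrr.
Qed.

End IntegralKernel.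

(** * The quotient *)

Section CellularQuotient.
Variables (R S : idomainType) (pi : {rmorphism R -> S}).
Variables (D : diagram_data R) (Q : quotient_data S D).
Hypotheses (hD : is_diagram_sequence D) (hQ : is_quotient_tower pi Q).
Variable r : nat.

Local Notation mS := (mB (toS Q)).
Local Notation mK := (mB (iK Q)).
Local Notation cK := (cB (iK Q)).
Local Notation dK := (dB (iK Q)).
Local Notation upK := (up (iK Q)).
Local Notation upS := (up (toS Q)).
Local Notation qb := (@quotient_basis R S D Q r).
Local Notation hbcS := (bcS hQ).
Local Notation hbcK := (bcK hQ).
Local Notation hstarK := (starK_iK hQ).
Local Notation hstarS := (starSE hQ).

Lemma qb_mS (lam : perm_pt (perm Q) r) (s t : StdPerm (perm Q) (val lam)) :
  qb s t = phiS Q r (mS (val s, val t)).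
Proof.
rewrite /quotient_basis /mB /mpair /=.
by case/and3P: (valP s) => _ /eqP ->.
Qed.

Lemma phiS_perm_free : lfree (@perm_pairs _ _ _ Q r) (phiS Q r \o mS (r := r)).
Proof.
move=> k hk p hp; have /phiS_eq0 : phiS Q r (\sum_(p | perm_pairs Q p) k p *:
  mS p) = 0.
  by rewrite -[RHS]hk linear_sum; apply: eq_bigr => q _; rewrite linearZ.
move=> /(_ pi hQ); rewrite /ker_phi (toK_sum hQ) linear_sum.
under eq_bigr do rewrite linearZ /=.
move=> hk'; apply/eqP; rewrite -tofrac_eq0; apply/eqP.
exact: (phi_perm_free hD hQ (star_inv_prev hD hQ r) hk' hp).
Qed.

Section WithLift.
Variable nS : vseq D r * vseq D r -> spA Q r.
Hypothesis nSE : forall p, path_pair p -> toK Q r (nS p) = nK Q p.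

Lemma phiS_nS p : nonperm_pairs Q p -> phiS Q r (nS p) = 0.
Proof.
by move=> hp; apply/(phiS_eq0 hQ);
  apply: (int_ker nSE (@nK_ker _ _ _ _ _ hD hQ r)).
Qed.

Lemma nS_perm p : perm_pairs Q p -> nS p = mS p.
Proof. exact: (int_perm hD hQ nSE (@nK_perm_pairs _ _ _ _ _ hD hQ r)). Qed.

(** Expansion in [nS] instead of Murphy elements makes the non-permissible terms vanish under
    [phiS]; the other terms are permissible Murphy elements at higher points. *)
Lemma qb_above (lam : perm_pt (perm Q) r) x : upS (val lam) x ->
  above qb lam (phiS Q r x).
Proof.
move=> hx; have {hx} : spn (pair_above (val lam)) nS x.
  apply/(int_spn hD hQ nSE (@nK_tri _ _ _ _ _ hD hQ r)) => //.
    by move=> p /andP[].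
  exact: pair_above_up.
have hN := cell_span_submod qb (fun mu => (lam < mu)%O).
apply: (spn_min (N := fun x => above qb lam (phiS Q r x))).
  split=> [|k y z hy hz]; first by rewrite linear0; exact: submod0 hN.
  by rewrite linearP; exact: hN.2.
move=> [s t] /andP[hp ls]; have [pp|np] := boolP (perm_pair Q (s, t));
  last first.
  by rewrite phiS_nS ?/nonperm_pairs ?hp //; exact: submod0 hN.
rewrite nS_perm ?/perm_pairs ?hp //.
have /and3P[/= ps ptt /eqP e] := hp; have /andP[/= pps ppt] := pp.
have hs : [&& is_path s, tip s == tip s & perm_path (perm Q) s] by rewrite ps
  eqxx.
have ht : [&& is_path t, tip t == tip s & perm_path (perm Q) t] by rewrite ptt
  e eqxx.
pose mu : perm_pt (perm Q) r := exist _ (tip s) (perm_path_tip pps).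
have := @cell_span_gen S (QS Q r) _ _ _ qb (fun mu => (lam < mu)%O) mu
  (exist _ s hs) (exist _ t ht).
rewrite qb_mS; apply; rewrite Order.SubPreorderTheory.ltEsub; exact: ls.
Qed.

(** Inverts the triangularity of [zpath_tri]. No left path factor has entered yet, so in [qb_cell]
    the resulting coefficients cannot depend on [s]. *)
Lemma zpath_spn (lam : pt D r) x :
  spn_mod (upK lam) (path_to lam) (@zpath _ _ _ Q r) (cK lam * x).
Proof.
have hN := spn_mod_submod (up_submod (iK Q) lam) (path_to lam) (@zpath _ _ _ Q
  r).
apply: (rspan_min hN _ _ (rspan_mulr hD hbcK lam x)) => [y|w].
  exact: spn_mod_sub.
elim: {w}_.+1 {-2}w (ltnSn #|[pred v | vabove w v]|) => // n IH w hn hw.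
have [pw /eqP tw] := andP hw.
rewrite -(subKr (zpath Q w) (_ * _)); apply: (submodB hN).
  exact: (spn_mod_gen (up_submod (iK Q) lam)).
have := zpath_tri hD hQ pw; rewrite tw mulrBr /zpath tw.
apply: (rspan_min hN) => [y|v /andP[hv wv]]; first exact: spn_mod_sub.
apply: IH => //; rewrite -ltnS; apply: leq_trans hn; rewrite ltnS.
apply: proper_card; apply/properP; split.
  by apply/subsetP => u; rewrite !inE; exact: vabove_trans.
by exists v; rewrite !inE ?vabove_irr.
Qed.

Lemma nK_zpath (s v : vseq D r) : perm_path (perm Q) s -> tip s = tip v ->
  nK Q (s, v) = starK Q r (dK s) * zpath Q v.
Proof.
move=> ps e; rewrite /nK /=; case: ifP => // pv.
by rewrite (starK_zpath hD hQ) (apath_perm ps) /zpath (apath_perm pv) e mulrA.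
Qed.

(** The coefficients must be integral and independent of [s]. Those of [zpath_spn] are independent
    of [s] but lie in the fraction field; those of the integral basis, computed for the single
    choice [s = t], are integral. Their agreement gives both properties. *)
Lemma qb_cell (lam : perm_pt (perm Q) r) (t : StdPerm (perm Q) (val lam)) a :
  exists c : StdPerm (perm Q) (val lam) -> S,
    forall s, above qb lam (qb s t * a - \sum_v c v *: qb s v).
Proof.
have [y <-] := phiS_surj hQ a; set l := val lam.
have pth (s : StdPerm (perm Q) l) : [/\ path_to l (val s), tip (val s) = l &
    perm_path (perm Q) (val s)].
  by rewrite /path_to; case/and3P: (valP s) => -> /eqP ->; rewrite eqxx.
have [pt tt ppt] := pth t.
have [k hk] := int_span hD hQ nSE (@nK_tri _ _ _ _ _ hD hQ r) (mS (val t, val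
  t) * y).
have [c hc] := zpath_spn l (dK (val t) * toK Q r y).
have hS (s : StdPerm (perm Q) l) : toK Q r (mS (val s, val t) * y) =
    starK Q r (dK (val s)) * (cK l * (dK (val t) * toK Q r y)).
  rewrite rmorphM /= -[toK Q r (mS _)]/(mK (val s, val t)).
  by have [_ ts _] := pth s; rewrite (mBE hstarK _ ts) !mulrA.
have hup (s : StdPerm (perm Q) l) : upK l (toK Q r (mS (val s, val t) * y) -
    \sum_(v | path_to l v) c v *: nK Q (val s, v)).
  have [_ ts pps] := pth s.
  have -> : \sum_(v | path_to l v) c v *: nK Q (val s, v) =
      starK Q r (dK (val s)) * \sum_(v | path_to l v) c v *: zpath Q v.
    rewrite mulr_sumr; apply: eq_bigr => v /andP[_ /eqP tv].
    by rewrite nK_zpath ?ts // scalerAr.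
  by rewrite hS -mulrBr; exact: (up_mull hD hbcK).
(* Both families expand one element in the free family [nK] modulo higher cells, and a pair
   [(val t, v)] at [l] is not above [l]. *)
have kc v : path_to l v -> c v = tofrac (k (val t, v)).
  move=> hv; pose c' p := if (p.1 == val t) && path_to l p.2 then c p.2 else 0.
  have hE : toK Q r (mS (val t, val t) * y) -
      \sum_(v | path_to l v) c v *: nK Q (val t, v) =
      \sum_(p | path_pair p) (tofrac (k p) - c' p) *: nK Q p.
    under [RHS]eq_bigr do rewrite scalerBl.
    rewrite hk (toK_sum hQ) sumrB; congr (_ - _).
      by apply: eq_bigr => p /nSE ->.
    rewrite [RHS](bigID (fun p => (p.1 == val t) && path_to l p.2)) /=.
    rewrite [X in _ = _ + X]big1 ?addr0; last first.
      by move=> p /andP[_ /negPf np]; rewrite /c' np scale0r.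
    rewrite [RHS](reindex_onto (fun w => (val t, w)) snd) /=; last first.
      by move=> [u w] /= /and3P[_ /eqP -> _].
    apply: eq_big => [w|w hw]; last by rewrite /c' /= eqxx hw.
    rewrite !eqxx andbT /=; case hw: (path_to l w); rewrite ?andbF ?andbT //.
    by have [] := path_pairP pt hw.
  have [pp e] := path_pairP pt hv.
  have sub p : pair_above l p -> path_pair p by case/andP.
  have hU : spn (pair_above l) (nK Q (r := r)) (toK Q r (mS (val t, val t) * y)
    -
      \sum_(v | path_to l v) c v *: nK Q (val t, v)).
    by apply/(nK_spn hD hQ) => //; [exact: pair_above_up | exact: hup].
  have := lfree_disjoint (nK_free hD hQ (r := r)) sub hE hU pp.
  rewrite /pair_above pp /= e ltxx /c' /= eqxx hv => /(_ isT)/eqP.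
  by rewrite subr_eq0 => /eqP.
exists (fun v => k (val t, val v)) => s.
have [ps ts pps] := pth s.
have : upS l (mS (val s, val t) * y - \sum_(v | path_to l v) k (val t, v) *: nS
  (val s, v)).
  apply: (toK_descend hD hQ) => [p /andP[]//|].
  have := hup s; rewrite rmorphB /= (toK_sum hQ).
  congr (spn _ _ (_ - _)); apply: eq_bigr => v hv; rewrite kc // nSE //.
  by have [] := path_pairP ps hv.
move=> /qb_above; congr (above _ _ _); rewrite linearB /= rmorphM /= -qb_mS.
(* The terms with [v] not permissible die in the quotient, and the sum shrinks to [StdPerm]. *)
congr (_ - _); rewrite linear_sum (bigID (perm_path (perm Q) (r := r))) /=.
rewrite [X in _ + X]big1 ?addr0; last first.
  move=> v /andP[hv nv]; rewrite linearZ /= phiS_nS ?scaler0 //.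
  by rewrite /nonperm_pairs (path_pairP ps hv).1 /perm_pair /= negb_and nv orbT.
rewrite (sum_reindex (h := val : StdPerm (perm Q) l -> vseq D r)).
- apply: eq_bigr => v _; rewrite linearZ /= qb_mS nS_perm //.
  have [hv _ ppv] := pth v.
  by rewrite /perm_pairs (path_pairP ps hv).1 /perm_pair /= pps ppv.
- exact: val_inj.
- by move=> v; have [hv _ ppv] := pth v; rewrite hv ppv.
move=> v /andP[/andP[hv tv] ppv].
have hv' : [&& is_path v, tip v == l & perm_path (perm Q) v] by rewrite hv tv.
by exists (exist _ v hv').
Qed.

Lemma phiS_perm_span x : spn (@perm_pairs _ _ _ Q r) (phiS Q r \o mS (r := r))
  x.
Proof.
have [y <-] := phiS_surj hQ x.
have [k ->] := int_span hD hQ nSE (@nK_tri _ _ _ _ _ hD hQ r) y.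
exists k; rewrite linear_sum (bigID (@perm_pair _ _ _ Q r)) /= [X in _ + X]big1
  ?addr0.
  by apply: eq_bigr => p hp; rewrite linearZ /= nS_perm.
by move=> p hp; rewrite linearZ /= phiS_nS // scaler0.
Qed.

End WithLift.

Lemma qb_basis : is_basis (cell_family qb).
Proof.
have [nS nSE] := nS_exists hD hQ r.
pose h (i : {lam : perm_pt (perm Q) r &
    (StdPerm (perm Q) (val lam) * StdPerm (perm Q) (val lam))%type}) :
  vseq D r * vseq D r := (val (tagged i).1, val (tagged i).2).
have tips (lam : pt D r) (s : StdPerm (perm Q) lam) :
    [/\ is_path (val s), tip (val s) = lam & perm_path (perm Q) (val s)].
  by case: s => s /= /and3P[-> /eqP -> ->].
have hinj : injective h.
  move=> [l1 [s1 t1]] [l2 [s2 t2]] [/= es et].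
  have el : l1 = l2.
    apply: val_inj; have [_ e1 _] := tips _ s1; have [_ e2 _] := tips _ s2.
    by rewrite -[LHS]e1 -[RHS]e2; congr tip; exact: es.
  by case: l2 / el in s2 t2 es et *; rewrite (val_inj es) (val_inj et).
have hP i : perm_pairs Q (h i).
  case: i => [lam [s t]]; rewrite /perm_pairs /path_pair /perm_pair /=.
  by have [-> -> ->] := tips _ s; have [-> -> ->] := tips _ t; rewrite eqxx.
have hsurj p : perm_pairs Q p -> exists i, h i = p.
  case: p => s t /andP[/and3P[/= ps ptt /eqP e] /andP[/= pps ppt]].
  have hs : [&& is_path s, tip s == tip s & perm_path (perm Q) s] by rewrite ps
    eqxx.
  have ht : [&& is_path t, tip t == tip s & perm_path (perm Q) t] by rewrite
    ptt e eqxx.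
  pose mu : perm_pt (perm Q) r := exist _ (tip s) (perm_path_tip pps).
  by exists (Tagged (fun lam : perm_pt (perm Q) r =>
    (StdPerm (perm Q) (val lam) * StdPerm (perm Q) (val lam))%type)
    (i := mu) (exist _ s hs, exist _ t ht)).
have qE i : cell_family qb i = (phiS Q r \o mS (r := r)) (h i).
  by case: i => lam [s t]; exact: qb_mS.
apply/is_basisP; split=> [k|x].
  under eq_bigr do rewrite qE.
  exact: (lfree_reindex hinj hP hsurj phiS_perm_free).
have [k ->] := spn_reindex hinj hP hsurj (phiS_perm_span nSE x).
by exists k; apply: eq_bigr => i _; rewrite qE.
Qed.

Lemma quotient_involution : exists starQ : QS Q r -> QS Q r,
  is_algebra_involution starQ /\
  forall a, starQ (phiS Q r a) = phiS Q r (starS Q r a).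
Proof.
have ex q : exists x, phiS Q r x == q.
  by have [x <-] := phiS_surj hQ q; exists x.
(* The chosen preimage is immaterial because the kernel is stable under [starS]. *)
pose starQ q := phiS Q r (starS Q r (xchoose (ex q))).
have starQE a : starQ (phiS Q r a) = phiS Q r (starS Q r a).
  apply/eqP; rewrite -subr_eq0 -linearB -linearB; apply/eqP/(phiS_eq0 hQ).
  apply: (ker_phi_star hD hQ); apply/(phiS_eq0 hQ); rewrite linearB /=.
  by rewrite (eqP (xchooseP (ex (phiS Q r a)))) subrr.
exists starQ; split=> //; split=> [k x y|x y|x].
- have [a <-] := phiS_surj hQ x; have [b <-] := phiS_surj hQ y.
  by rewrite -linearP !starQE linearP /= linearP.
- have [a <-] := phiS_surj hQ x; have [b <-] := phiS_surj hQ y.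
  by rewrite -rmorphM !starQE (starB_mul hD hbcS hstarS) rmorphM.
have [a <-] := phiS_surj hQ x.
by rewrite !starQE (starB_invol hD hbcS hstarS).
Qed.

Lemma quotient_cellular : exists starQ : QS Q r -> QS Q r,
  [/\ is_algebra_involution starQ,
      (forall a, starQ (phiS Q r a) = phiS Q r (starS Q r a)) &
      is_cell_datum qb starQ].
Proof.
have [starQ [inv starQE]] := quotient_involution; exists starQ; split=> //.
have [nS nSE] := nS_exists hD hQ r.
split=> //; [exact: qb_basis | exact: qb_cell nSE |] => lam s t.
have tip_val (u : StdPerm (perm Q) (val lam)) : tip (val u) = val lam.
  by case/and3P: (valP u) => _ /eqP.
(* Condition (b) holds here as an equality, since the cell generators are fixed by the
   involution. *)
rewrite !qb_mS starQE (mB_star hD hbcS hstarS) ?tip_val // subrr.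
exact: submod0 (cell_span_submod _ _).
Qed.

End CellularQuotient.

Theorem theorem2p7 (R S : idomainType) (pi : {rmorphism R -> S})
    (D : diagram_data R) (Q : quotient_data S D)
    (hD : is_diagram_sequence D) (hQ : is_quotient_tower pi Q) (r : nat) :
  [/\
    (* (1) *)
    (forall a : spA Q r, ker_phi a -> ker_phi (starS Q r a)),
    (* (1), (2) *)
    (exists starQ : QS Q r -> QS Q r,
      [/\ is_algebra_involution starQ,
          (forall a : spA Q r, starQ (phiS Q r a) = phiS Q r (starS Q r a)) &
          is_cell_datum (@quotient_basis R S D Q r) starQ]),
    (* (3): [mtilde Q lam s t] is an element of A_r^K; the antecedent says that
       it lies in A_r^S when both s and t are not permissible (it does so
       automatically when only one of them is not permissible) *)
    ((forall (lam : pt D r) (s t : StdPath lam),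
        ~~ perm_path (perm Q) (val s) -> ~~ perm_path (perm Q) (val t) ->
        exists x : spA Q r, toK Q r x = mtilde Q lam (val s) (val t)) ->
     exists kap : kappa_index Q r -> spA Q r,
       (forall i, toK Q r (kap i) = kappa i) /\
       is_basis_of (@ker_phi R S D Q r) kap) &
    (* (4) *)
    (forall a : spA Q r,
       ker_phi a <-> ideal_generated (@marginal_gen R S D Q r) a)].
Proof.
split.
- exact: ker_phi_star hD hQ r.
- exact: quotient_cellular hD hQ r.
- exact: kappa_basis hD hQ r.
- exact: ker_phiE hD hQ r.
Qed.
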